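(* Let $\zeta_1,\dots,\zeta_r$ be distinct points of $\Omega$, let $\tau_1,\dots,\tau_r\in\mathbb{C}$ be not all zero, and set $$m^*(\zeta,\tau)=\min\{\|f\|_\infty : f\in H^\infty(\Omega),\ f(\zeta_1)=\tau_1,\dots,f(\zeta_r)=\tau_r\}.$$ The classical Pick-Nevanlinna problem (find an analytic function $f$ on $\Omega$ with modulus bounded by $1$ such that $f(\zeta_j)=\tau_j$, $1\leqslant j\leqslant r$) has a solution if and only if $m^*(\zeta,\tau)\leqslant 1$; if, in addition, $m^*(\zeta,\tau)=1$, the solution is unique.
   Context: $\Omega\subset\mathbb{C}$ is a bounded connected open set with $k$ holes ($k\ge 0$); its boundary consists of the exterior boundary $\Gamma_0$ and the interior boundary curves $\Gamma_1,\dots,\Gamma_k$, all simple closed analytic curves, pairwise disjoint. $H^\infty(\Omega)$ is the space of bounded holomorphic functions on $\Omega$ with norm $\|f\|_\infty=\sup_{z\in\Omega}|f(z)|$. *)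

(* Defs.v *)
From HB Require Import structures.
From mathcomp Require Import all_boot all_order all_algebra.
From mathcomp Require Import all_classical all_reals all_analysis.
From mathcomp Require Export complex.
Export numFieldNormedType.Exports.

Set Implicit Arguments.
Unset Strict Implicit.
Unset Printing Implicit Defensive.

Import Order.TTheory GRing.Theory Num.Theory.
Local Open Scope classical_set_scope.
Local Open Scope ring_scope.

(* The complex plane over R.  Typing R[i] as a numFieldType is what gives it its topology and its
   structure of normed module over itself, hence complex derivatives. *)
Definition cplx (R : realType) : numFieldType := R[i].

(* The modulus with values in R; the generic norm `|z| has values in R[i]. *)
Definition modulus (R : realType) (z : cplx R) : R :=
  ComplexField.Normc.normc z.

Definition boundary (T : topologicalType) (A : set T) : set T :=
  closure A `\` A°.

(* For open U, complex differentiability at each point of U depends only on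
   the values of f on U. *)
Definition holomorphic_on (R : realType) (U : set (cplx R))
    (f : cplx R -> cplx R) : Prop :=
  forall z, U z -> derivable f z 1.

Definition unit_circle (R : realType) : set (cplx R) :=
  [set z | modulus z = 1].

(* A simple closed analytic curve, as a point set: the image of the unit
   circle under a one-to-one holomorphic map of a neighbourhood of it. *)
Definition analytic_jordan_curve (R : realType) (G : set (cplx R)) : Prop :=
  exists (U : set (cplx R)) (g : cplx R -> cplx R),
    [/\ open U, @unit_circle R `<=` U, holomorphic_on U g, set_inj U g
      & G = g @` @unit_circle R].

Definition components (T : topologicalType) (A : set T) : set (set T) :=
  connected_component A @` A.

Definition holes (R : realType) (Omega : set (cplx R)) : set (set (cplx R)) :=
  [set H | components (~` Omega) H /\ bounded_set H].

(* Omega has exactly k holes; Gamma ord0 is the exterior boundary, and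
   Gamma (lift ord0 j), for j : 'I_k, are the interior boundary curves, one
   around each hole. *)
Definition analytic_domain (R : realType) (k : nat) (Omega : set (cplx R))
    (Gamma : 'I_k.+1 -> set (cplx R)) : Prop :=
  [/\ [/\ open Omega, connected Omega & bounded_set Omega],
      (forall i, analytic_jordan_curve (Gamma i)),
      trivIset [set: 'I_k.+1] Gamma /\
      boundary Omega = \bigcup_(i in [set: 'I_k.+1]) Gamma i,
      (forall E, components (~` Omega) E -> ~ bounded_set E ->
         boundary E = Gamma ord0)
    & exists H : 'I_k -> set (cplx R),
        set_bij [set: 'I_k] (holes Omega) H /\
        (forall j, boundary (H j) = Gamma (lift ord0 j))].

(* Functions on Omega are represented by total functions, of which only the
   values on Omega matter. *)
Definition Hinfty (R : realType) (Omega : set (cplx R)) :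
    set (cplx R -> cplx R) :=
  [set f | holomorphic_on Omega f /\ [bounded f z | z in Omega]].

Definition Hinfty_norm (R : realType) (Omega : set (cplx R))
    (f : cplx R -> cplx R) : R :=
  sup [set modulus (f z) | z in Omega].

Definition interpolates (R : realType) (r : nat) (zeta tau : 'I_r -> cplx R)
    (f : cplx R -> cplx R) : Prop :=
  forall j, f (zeta j) = tau j.

Definition interpolant_norms (R : realType) (Omega : set (cplx R)) (r : nat)
    (zeta tau : 'I_r -> cplx R) : set R :=
  [set Hinfty_norm Omega f | f in
     [set f | Hinfty Omega f /\ interpolates zeta tau f]].

Definition is_min (R : realType) (S : set R) (m : R) : Prop :=
  S m /\ lbound S m.

Definition pick_nevanlinna_solution (R : realType) (Omega : set (cplx R))
    (r : nat) (zeta tau : 'I_r -> cplx R) (f : cplx R -> cplx R) : Prop :=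
  [/\ holomorphic_on Omega f,
      (forall z, Omega z -> modulus (f z) <= 1)
    & interpolates zeta tau f].

(* Main.v *)
Require Import Defs.
From HB Require Import structures.
From mathcomp Require Import all_boot all_order all_algebra.
From mathcomp Require Import all_classical all_reals all_analysis.
From mathcomp Require Import zify ring lra.
Import Order.TTheory GRing.Theory Num.Theory.
Local Open Scope classical_set_scope.
Local Open Scope ring_scope.

(** Existence of the minimum is Montel's theorem, obtained without subsequences: the limit of a
    minimizing sequence along an ultrafilter, taken pointwise, is holomorphic because each member
    has a second order Taylor expansion with uniform constants.

    Uniqueness uses no boundary behaviour.  If f <> g are solutions, put u = (f + g)/2 and
    w = ((f - g)/2)^2 / 2.  The parallelogram law gives |u| + |w| <= 1, and w is not identically 0.
    By the maximum modulus principle |u| < 1 on Omega, so w can be divided by its zeros at the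
    zeta_j and rescaled without destroying |u| + |w| <= 1.  Once w (zeta_j) <> 0 for all j, choose a
    bounded holomorphic h with w h = tau at the zeta_j: for small e > 0 the function
    (u + e w h)/(1 + e) interpolates tau and has modulus at most 1/(1 + e), so m* < 1.

    Taylor expansions come from a Cauchy formula in which the contour integral is replaced by dyadic
    Riemann sums over a square: Goursat's bisection argument applies verbatim to these sums, and an
    ultrafilter turns them into a bounded linear functional Lam with f z = Lam (f / (. - z)). *)

Set Implicit Arguments.
Unset Strict Implicit.
Unset Printing Implicit Defensive.

Local Arguments modulus : simpl never.

(** * Modulus and complex derivatives *)

Section Modulus.
Variable R : realType.
Implicit Types z w : cplx R.

Lemma modulusM z w : modulus (z * w) = modulus z * modulus w.
Proof. exact: ComplexField.Normc.normcM. Qed.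

Lemma modulusD z w : modulus (z + w) <= modulus z + modulus w.
Proof. exact: le_normcD. Qed.

Lemma modulusN z : modulus (- z) = modulus z.
Proof. exact: normcN. Qed.

Lemma modulus0 : modulus (0 : cplx R) = 0.
Proof. exact: ComplexField.Normc.normc0. Qed.

Lemma modulus1 : modulus (1 : cplx R) = 1.
Proof. exact: ComplexField.Normc.normc1. Qed.

Lemma modulusV z : modulus z^-1 = (modulus z)^-1.
Proof. exact: ComplexField.Normc.normcV. Qed.

Lemma modulus_ge0 z : 0 <= modulus z.
Proof. by case: z => a b; exact: Num.Theory.sqrtr_ge0. Qed.

Lemma modulus_eq0 z : (modulus z == 0) = (z == 0).
Proof.
apply/eqP/eqP => [/ComplexField.Normc.eq0_normc//|->]; exact: modulus0.
Qed.

Lemma modulus_gt0 z : (0 < modulus z) = (z != 0).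
Proof. by rewrite lt_def modulus_eq0 modulus_ge0 andbT. Qed.

Lemma modulusX z n : modulus (z ^+ n) = modulus z ^+ n.
Proof.
by elim: n => [|n IHn]; rewrite ?expr0 ?modulus1// !exprS modulusM IHn.
Qed.

Lemma modulusB z w : modulus (z - w) <= modulus z + modulus w.
Proof. by rewrite (le_trans (modulusD _ _))// modulusN. Qed.

Lemma modulus_distC z w : modulus (z - w) = modulus (w - z).
Proof. by rewrite -modulusN opprB. Qed.

Lemma modulus_triangle z w : modulus z - modulus w <= modulus (z - w).
Proof. by rewrite lerBlDr -{1}(subrK w z); exact: modulusD. Qed.

Lemma modulus_real (x : R) : modulus (x%:C%C : cplx R) = `|x|.
Proof. by rewrite /modulus/= expr0n/= addr0 sqrtr_sqr. Qed.

Lemma modulus_Im1 : modulus ('i%C : cplx R) = 1.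
Proof. by rewrite /modulus/= expr0n/= add0r expr1n sqrtr1. Qed.

Lemma normE z : `|z| = (modulus z)%:C%C.
Proof. by []. Qed.

Lemma Re_le_modulus z : `|complex.Re z| <= modulus z.
Proof.
case: z => a b; rewrite /modulus/= -sqrtr_sqr ler_sqrt ?lerDl ?sqr_ge0//.
by rewrite addr_ge0 ?sqr_ge0.
Qed.

Lemma Im_le_modulus z : `|complex.Im z| <= modulus z.
Proof.
case: z => a b; rewrite /modulus/= -sqrtr_sqr ler_sqrt ?lerDr ?sqr_ge0//.
by rewrite addr_ge0 ?sqr_ge0.
Qed.

Lemma modulus_le_ReIm z : modulus z <= `|complex.Re z| + `|complex.Im z|.
Proof.
rewrite {1}[z]complexE (le_trans (modulusD _ _))// modulusM modulus_Im1 mul1r.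
by rewrite !modulus_real.
Qed.

Lemma modulus_sqr z : modulus z ^+ 2 = complex.Re z ^+ 2 + complex.Im z ^+ 2.
Proof. by case: z => a b; rewrite /modulus/= sqr_sqrtr ?addr_ge0 ?sqr_ge0. Qed.

Lemma modulus_parallelogram z w :
  modulus (z + w) ^+ 2 + modulus (z - w) ^+ 2 =
  2 * (modulus z ^+ 2 + modulus w ^+ 2).
Proof. by case: z w => a b [c d]; rewrite !modulus_sqr/=; ring. Qed.

Lemma modulus_nat n : modulus (n%:R : cplx R) = n%:R.
Proof.
have -> : (n%:R : cplx R) = (n%:R : R)%:C%C by rewrite rmorph_nat.
by rewrite modulus_real ger0_norm.
Qed.

(** The order of [R[i]] makes a positive radius a real one: its imaginary part is 0, so its real
    part can serve instead. This passes from the topology of [cplx R] to real radii. *)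
Lemma nbhs_modulusP z (A : set (cplx R)) :
  nbhs z A <-> exists2 r : R, 0 < r & forall w, modulus (w - z) < r -> A w.
Proof.
split.
  move=> /nbhs_ballP[e /= e0 eA]; exists (complex.Re e).
    by move: e e0 {eA} => [a b]; rewrite ltcE/= => /andP[].
  move=> w wz; apply: eA; rewrite -ball_normE/=.
  move: e e0 wz => [a b]; rewrite !ltcE/= => /andP[/eqP -> a0] wz.
  by rewrite eqxx/=; rewrite -[X in X < _]/(modulus (z-w)) modulus_distC.
move=> [r r0 rA]; apply/nbhs_ballP; exists (r%:C%C : cplx R) => /=.
  by rewrite ltcE/= eqxx.
move=> w; rewrite -ball_normE/= ltcE/= => /andP[_ wz].
by apply: rA; rewrite modulus_distC.
Qed.

Lemma open_modulusP (A : set (cplx R)) z : open A -> A z ->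
  exists2 r : R, 0 < r & forall w, modulus (w - z) < r -> A w.
Proof. by move=> oA Az; apply/nbhs_modulusP; exact: open_nbhs_nbhs. Qed.

(** Differentiability in the form of a first order expansion: without a quotient, the point [w = z]
    needs no exclusion. *)
Lemma derivable_modulusP (f : cplx R -> cplx R) z :
  derivable f z 1 <->
  exists b : cplx R, forall e : R, 0 < e -> exists2 d : R, 0 < d &
    forall w, modulus (w - z) < d ->
      modulus (f w - f z - b * (w - z)) <= e * modulus (w - z).
Proof.
split.
- have -> : derivable f z 1 = cvg ((fun h : cplx R =>
      h^-1 *: ((f \o shift z) (h *: (1 : cplx R)) - f z)) @ 0^') by [].
  move=> /cvg_ex[b fb]; exists b => e e0.
  have ee0 : 0 < (e%:C%C : cplx R) by rewrite ltcE/= eqxx.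
  have /(_ _ _ ee0) := (@cvgrPdist_lt _ (cplx R) _ _ _ _ _).1 fb.
  rewrite near_withinE => /nbhs_modulusP[d d0 dP]; exists d => // w wz.
  have [->|wz0] := eqVneq w z; first by rewrite !subrr mulr0 subrr modulus0 mulr0.
  have h0 : w - z != 0 by rewrite subr_eq0.
  have := dP (w - z); rewrite subr0 => /(_ wz h0).
  rewrite /= [X in f (X + _)]mulr1 subrK normE ltcE/= => /andP[_].
  rewrite -[X in X < _]/(modulus (b - (w-z)^-1 * (f w - f z))) => H.
  have -> : f w - f z - b * (w - z) = - (b - (w-z)^-1 * (f w - f z)) * (w - z).
    by field.
  by rewrite modulusM modulusN ler_wpM2r ?modulus_ge0// ltW.
- move=> [b fb]; apply/cvg_ex; exists b; apply/cvgrPdist_lt => e e0.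
  rewrite near_withinE.
  have /fb [d d0 dP] : 0 < complex.Re e / 2.
    by move: e e0 => [a c]; rewrite ltcE/= => /andP[_ a0]; rewrite divr_gt0.
  apply/nbhs_modulusP; exists d => // h; rewrite subr0 => hd h0.
  have := dP (h + z); rewrite addrK => /(_ hd) H.
  rewrite /= [X in f (X + _)]mulr1.
  have -> : b - h^-1 *: (f (h + z) - f z) = - (h^-1 * (f (h+z) - f z - b * h)).
    by rewrite -[_ *: _]/(_ * _); field.
  rewrite normE modulusN modulusM modulusV.
  have hp : 0 < modulus h by rewrite modulus_gt0.
  suff : (modulus h)^-1 * modulus (f (h + z) - f z - b * h) < complex.Re e.
    by move: e e0 {H fb dP} => [a c]; rewrite !ltcE/= => /andP[-> _ ->].
  rewrite mulrC ltr_pdivrMr//; apply: le_lt_trans H _.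
  rewrite ltr_pM2r// gtr_pMr ?invf_lt1 ?ltr1n//.
  by move: e e0 {fb dP} => [a c]; rewrite ltcE/= => /andP[].
Qed.
End Modulus.

(** * Generalized limits of bounded sequences *)

Section GeneralizedLimit.
Variable R : realType.
Implicit Types (x y : nat -> cplx R) (l c : cplx R).

Definition bounded_seq x := exists M, forall n, modulus (x n) <= M.

(** A Banach limit without shift invariance. The index [n0] in the last clause lets bounds that hold
    only eventually pass to the limit. *)
Definition generalized_limit (L : (nat -> cplx R) -> cplx R) : Prop :=
  [/\ (forall x y, bounded_seq x -> bounded_seq y ->
         L (fun n => x n + y n) = L x + L y),
      (forall c x, bounded_seq x -> L (fun n => c * x n) = c * L x),
      (forall c, L (fun=> c) = c)
    & (forall x M n0, bounded_seq x ->
         (forall n, (n0 <= n)%N -> modulus (x n) <= M) -> modulus (L x) <= M)].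

Lemma eq_modulus_small z w :
  (forall e : R, 0 < e -> modulus (z - w : cplx R) < e) -> z = w.
Proof.
move=> H; apply/eqP; rewrite -subr_eq0 -modulus_eq0; apply: contraT => n0.
have /H : 0 < modulus (z - w) by rewrite lt_def n0 modulus_ge0.
by rewrite ltxx.
Qed.

(** The limit is taken along an ultrafilter [U] finer than [\oo]: a bounded real sequence has a
    cluster point along [U] by compactness of a segment, and for an ultrafilter a cluster point is a
    limit. Real and imaginary parts are treated separately. *)
Lemma generalized_limit_exists : exists L, generalized_limit L.
Proof.
have [U [UU ooU]] := @ultraFilterLemma nat \oo _.
have UF : ProperFilter U by case: UU.
pose lims x := [set l | forall e : R, 0 < e -> U [set n | modulus (x n - l) < e]].
have real_lim (u : nat -> R) (M : R) : (forall n, `|u n| <= M) ->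
    exists a : R, forall e : R, 0 < e -> U [set n | `|u n - a| < e].
  move=> uM.
  have fU : (u @ U) `[-M, M]%classic.
    have : U [set n | `[-M, M]%classic (u n)]; last by [].
    by apply: filterS filterT => n _; move: (uM n); rewrite /= in_itv/= ler_norml.
  have [a [_ ua]] := @segment_compact R (-M) M (u @ U) _ fU.
  exists a => e e0.
  (* Otherwise the complement is in [U], and the values of [u] on it avoid the ball around the
     cluster point [a]. *)
  have [//|UC] := in_ultra_setVsetC [set n | `|u n - a| < e] UU.
  have [_ [[n /= nC <-] ae]] := ua (u @` ~` [set n | `|u n - a| < e]) (ball a e)
    (filterS (@preimage_image _ _ u _) UC) (nbhsx_ballx a e e0).
  by exfalso; apply: nC; rewrite distrC.
have lim_ex x : bounded_seq x -> lims x !=set0.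
  move=> [M xM].
  have [n|a aP] := real_lim (fun n => complex.Re (x n)) M.
    by rewrite (le_trans (Re_le_modulus _)).
  have [n|b bP] := real_lim (fun n => complex.Im (x n)) M.
    by rewrite (le_trans (Im_le_modulus _)).
  exists (a +i* b)%C => e e0.
  have e20 : 0 < e / 2 by rewrite divr_gt0.
  apply: filterS (filterI (aP _ e20) (bP _ e20)) => n /= [h1 h2].
  apply: le_lt_trans (modulus_le_ReIm _) _.
  by rewrite [e]splitr; case: (x n) h1 h2 => c d /= h1 h2; rewrite ltrD.
have lim_uniq x l l' : lims x l -> lims x l' -> l = l'.
  move=> xl xl'; apply: eq_modulus_small => e e0.
  have e20 : 0 < e / 2 by rewrite divr_gt0.
  have [n [/= h1 h2]] := filter_ex (filterI (xl _ e20) (xl' _ e20)).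
  rewrite -[l](subrK (x n)) -addrA [e]splitr.
  by rewrite (le_lt_trans (modulusD _ _))// ltrD// modulus_distC.
(* The default 0 is taken only by sequences without a limit along [U], hence never by bounded
   ones. *)
pose L x := xget 0 (lims x).
have LP x : bounded_seq x -> lims x (L x).
  by move=> /lim_ex[l xl]; rewrite /L; apply: (xgetPex 0); exists l.
exists L; split.
- move=> x y bx by_; apply: (lim_uniq (fun n => x n + y n)).
    apply: LP; case: bx by_ => [M xM] [M' yM']; exists (M + M') => n.
    by rewrite (le_trans (modulusD _ _))// lerD.
  move=> e e0; have e20 : 0 < e / 2 by rewrite divr_gt0.
  apply: filterS (filterI (LP _ bx _ e20) (LP _ by_ _ e20)) => n /= [h1 h2].
  rewrite opprD addrACA (le_lt_trans (modulusD _ _))// [e]splitr.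
  by rewrite ltrD.
- move=> c x bx; apply: (lim_uniq (fun n => c * x n)).
    apply: LP; case: bx => [M xM]; exists (modulus c * M) => n.
    by rewrite modulusM ler_wpM2l ?modulus_ge0.
  move=> e e0; have c1 : 0 < modulus c + 1 by rewrite ltr_wpDl ?modulus_ge0.
  have e20 : 0 < e / (modulus c + 1) by rewrite divr_gt0.
  apply: filterS (LP _ bx _ e20) => n /= h.
  rewrite -mulrBr modulusM.
  apply: (@le_lt_trans _ _ ((modulus c + 1) * modulus (x n - L x))).
    by rewrite ler_wpM2r ?modulus_ge0 ?lerDl.
  by rewrite mulrC -ltr_pdivlMr.
- move=> c; apply: (lim_uniq (fun=> c)).
    by apply: LP; exists (modulus c).
  move=> e e0; apply: filterS filterT => n _ /=.
  by rewrite subrr modulus0.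
- move=> x M n0 bx xM; apply/ler_addgt0Pr => e e0.
  have Un0 : U [set n | (n0 <= n)%N] by apply: ooU; exists n0.
  have [n [/= h1 h2]] := filter_ex (filterI (LP _ bx _ e0) Un0).
  rewrite -[L x](subrK (x n)) (le_trans (modulusD _ _))// addrC lerD//.
    exact: xM.
  by rewrite modulus_distC ltW.
Qed.
End GeneralizedLimit.

(** * Riemann sums over segments and squares *)

Section ContourSums.
Variable R : realType.
Implicit Types (g h : cplx R -> cplx R) (a d z : cplx R).

(** The left-endpoint Riemann sum, with [2 ^ n] equal steps, of the integral of [g] from [a] to
    [a + d]. Recursion by halving makes the bisection identities hold exactly rather than in the
    limit. *)
Fixpoint seg_sum n g a d : cplx R :=
  if n is m.+1 then seg_sum m g a (d / 2) + seg_sum m g (a + d / 2) (d / 2)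
  else g a * d.

(** The contour is run counterclockwise: bottom, right, top reversed, left reversed. The reversed
    sides enter as minus the sum in the forward direction, so that opposite sides use matching
    sample points. *)
Definition sq_sum n g a d : cplx R :=
  seg_sum n g a d + seg_sum n g (a + d) ('i%C * d)
  - seg_sum n g (a + 'i%C * d) d - seg_sum n g a ('i%C * d).

Definition segment a d : set (cplx R) :=
  [set z | exists2 t : R, 0 <= t <= 1 & z = a + t%:C%C * d].

Definition sq_boundary a d : set (cplx R) :=
  [set z | [\/ segment a d z, segment (a + d) ('i%C * d) z,
               segment (a + 'i%C * d) d z | segment a ('i%C * d) z]].

Definition square a (s : R) : set (cplx R) :=
  [set z | complex.Re a <= complex.Re z <= complex.Re a + s /\
           complex.Im a <= complex.Im z <= complex.Im a + s].

Lemma segment_start a d : segment a d a.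
Proof. by exists 0; rewrite ?lexx ?ler01// mul0r addr0. Qed.

Lemma segment_end a d : segment a d (a + d).
Proof. by exists 1; rewrite ?lexx ?ler01// mul1r. Qed.

Lemma real_complex_half (t : R) : (t / 2)%:C%C = t%:C%C / 2 :> cplx R.
Proof. by rewrite rmorphM fmorphV rmorph_nat. Qed.

Lemma segment_left a d z : segment a (d / 2) z -> segment a d z.
Proof.
move=> [t t01 ->]; exists (t / 2); first lra.
by rewrite real_complex_half; field.
Qed.

Lemma segment_right a d z : segment (a + d / 2) (d / 2) z -> segment a d z.
Proof.
move=> [t t01 ->]; exists ((1 + t) / 2); first lra.
by rewrite real_complex_half rmorphD rmorph1; field.
Qed.

Lemma modulus_half d : modulus (d / 2) = modulus d / 2.
Proof. by rewrite modulusM modulusV (modulus_nat R 2). Qed.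

Lemma seg_sum_bound n g a d (B : R) :
  (forall z, segment a d z -> modulus (g z) <= B) ->
  modulus (seg_sum n g a d) <= B * modulus d.
Proof.
elim: n a d => [|n IHn] a d gB /=.
  by rewrite modulusM ler_wpM2r ?modulus_ge0// gB//; exact: segment_start.
rewrite (le_trans (modulusD _ _))// [leRHS](_ : _ =
  B * modulus (d / 2) + B * modulus (d / 2)); last first.
  by rewrite modulus_half; field.
by rewrite lerD// IHn// => z zs; apply: gB; [exact: segment_left|exact: segment_right].
Qed.

Lemma eq_seg_sum n g h a d : (forall z, segment a d z -> g z = h z) ->
  seg_sum n g a d = seg_sum n h a d.
Proof.
elim: n a d => [|n IHn] a d gh /=; first by rewrite gh//; exact: segment_start.
by congr (_ + _); apply: IHn => z zs; apply: gh;
  [exact: segment_left|exact: segment_right].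
Qed.

Lemma seg_sum_lin n (c : cplx R) g h a d :
  seg_sum n (fun z => c * g z + h z) a d = c * seg_sum n g a d + seg_sum n h a d.
Proof. by elim: n a d => [|n IHn] a d /=; rewrite ?IHn; ring. Qed.

Lemma seg_sum_affine n (u v : cplx R) a d :
  seg_sum n (fun z => u + v * z) a d =
  u * d + v * (a * d + d ^+ 2 / 2 * (1 - 2 ^- n)).
Proof.
elim: n a d => [|n IHn] a d /=; first by rewrite expr0 invr1 subrr mulr0 addr0; ring.
rewrite !IHn [2 ^+ n.+1]exprS invfM.
by move: (2 ^- n) => e; field.
Qed.

(** Each of the [2 ^ n] steps has length [modulus d / 2 ^ n] and costs at most [C] times its square;
    the increments of [G] telescope. *)
Lemma seg_sum_primitive n g (G : cplx R -> cplx R) a d (C : R) :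
  (forall z w, segment a d z -> segment a d w ->
    modulus (G w - G z - g z * (w - z)) <= C * modulus (w - z) ^+ 2) ->
  modulus (seg_sum n g a d - (G (a + d) - G a)) <= C * modulus d ^+ 2 / 2 ^+ n.
Proof.
elim: n a d => [|n IHn] a d gG /=.
  have := gG _ _ (segment_start a d) (segment_end a d).
  by rewrite [a + d - a]addrAC subrr add0r divr1 modulus_distC.
have H1 := IHn a (d / 2) (fun z w zs ws => gG z w (segment_left zs) (segment_left ws)).
have H2 := IHn (a + d / 2) (d / 2)
  (fun z w zs ws => gG z w (segment_right zs) (segment_right ws)).
have -> : C * modulus d ^+ 2 / 2 ^+ n.+1 =
  C * modulus (d / 2) ^+ 2 / 2 ^+ n + C * modulus (d / 2) ^+ 2 / 2 ^+ n.
  rewrite modulus_half [2 ^+ n.+1]exprS invfM.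
  by move: (2 ^- n) => e; field.
apply: le_trans (lerD H1 H2); apply: le_trans (modulusD _ _).
have -> : a + d / 2 + d / 2 = a + d by field.
by rewrite le_eqVlt; apply/orP; left; apply/eqP; congr modulus; ring.
Qed.

(** Each inner edge belongs to two quarters and occurs with opposite signs as the very same sum, so
    it cancels. Level [n.+1] on the square corresponds to level [n] on its quarters. *)
Lemma sq_sumS n g a d :
  sq_sum n.+1 g a d = sq_sum n g a (d / 2) + sq_sum n g (a + d / 2) (d / 2)
   + sq_sum n g (a + 'i%C * (d / 2)) (d / 2)
   + sq_sum n g (a + d / 2 + 'i%C * (d / 2)) (d / 2).
Proof.
rewrite /sq_sum /= -!mulrA.
have -> : a + d / 2 + d / 2 = a + d by field.
have -> : a + 'i%C * (d / 2) + 'i%C * (d / 2) = a + 'i%C * d by field.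
have -> : a + d / 2 + 'i%C * (d / 2) + d / 2 = a + d + 'i%C * (d / 2) by field.
have -> : a + 'i%C * (d / 2) + d / 2 = a + d / 2 + 'i%C * (d / 2) by ring.
have -> : a + d / 2 + 'i%C * (d / 2) + 'i%C * (d / 2) = a + 'i%C * d + d / 2 by field.
ring.
Qed.

Lemma modulus_iM d : modulus ('i%C * d) = modulus d.
Proof. by rewrite modulusM modulus_Im1 mul1r. Qed.

Lemma sq_sum_bound n g a d (B : R) :
  (forall z, sq_boundary a d z -> modulus (g z) <= B) ->
  modulus (sq_sum n g a d) <= 4 * (B * modulus d).
Proof.
move=> gB.
have H1 : modulus (seg_sum n g a d) <= B * modulus d.
  by apply: seg_sum_bound => z zs; apply: gB; apply: Or41.
have H2 : modulus (seg_sum n g (a + d) ('i%C * d)) <= B * modulus d.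
  by rewrite -[modulus d]modulus_iM; apply: seg_sum_bound => z zs; apply: gB; apply: Or42.
have H3 : modulus (seg_sum n g (a + 'i%C * d) d) <= B * modulus d.
  by apply: seg_sum_bound => z zs; apply: gB; apply: Or43.
have H4 : modulus (seg_sum n g a ('i%C * d)) <= B * modulus d.
  by rewrite -[modulus d]modulus_iM; apply: seg_sum_bound => z zs; apply: gB; apply: Or44.
have -> : 4 * (B * modulus d) =
  B * modulus d + B * modulus d + B * modulus d + B * modulus d by ring.
by rewrite /sq_sum (le_trans (modulusB _ _))// lerD//
  (le_trans (modulusB _ _))// lerD// (le_trans (modulusD _ _))// lerD.
Qed.

Lemma eq_sq_sum n g h a d : (forall z, sq_boundary a d z -> g z = h z) ->
  sq_sum n g a d = sq_sum n h a d.
Proof.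
move=> gh; rewrite /sq_sum; congr (_ + _ + _ + _).
- by apply: eq_seg_sum => z zs; apply: gh; apply: Or41.
- by apply: eq_seg_sum => z zs; apply: gh; apply: Or42.
- by congr (- _); apply: eq_seg_sum => z zs; apply: gh; apply: Or43.
- by congr (- _); apply: eq_seg_sum => z zs; apply: gh; apply: Or44.
Qed.

Lemma sq_sum_lin n (c : cplx R) g h a d :
  sq_sum n (fun z => c * g z + h z) a d = c * sq_sum n g a d + sq_sum n h a d.
Proof. by rewrite /sq_sum !seg_sum_lin; ring. Qed.

(** The sum vanishes exactly at every level: by [seg_sum_affine] the quadrature error depends on the
    side vector but not on the starting point, so it cancels between opposite sides. *)
Lemma sq_sum_affine n (u v : cplx R) a d :
  sq_sum n (fun z => u + v * z) a d = 0.
Proof.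
by rewrite /sq_sum !seg_sum_affine; move: (2 ^- n) => e; field.
Qed.

Lemma sq_boundary_square a (s : R) z : 0 <= s ->
  sq_boundary a s%:C%C z -> square a s z.
Proof.
move=> s0; case: a => a1 a2; rewrite /square /=.
case=> -[t /andP[t0 t1] ->] /=; rewrite ?(mul0r, mulr0, subr0, addr0, add0r, mul1r);
  have ts0 : 0 <= t * s by rewrite mulr_ge0.
all: have ts1 : t * s <= s by rewrite ler_piMl.
all: split; lra.
Qed.

Lemma square_dist a (s : R) z w : square a s z -> square a s w ->
  modulus (z - w) <= 2 * s.
Proof.
move=> [h1 h2] [h3 h4]; rewrite (le_trans (modulus_le_ReIm _))//.
move: a z w h1 h2 h3 h4 => [a1 a2] [z1 z2] [w1 w2] /= h1 h2 h3 h4.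
have : `|z1 - w1| <= s by rewrite ler_norml; lra.
have : `|z2 - w2| <= s by rewrite ler_norml; lra.
lra.
Qed.
End ContourSums.

(** * Goursat's lemma *)

Section Goursat.
Variable R : realType.
Implicit Types (g : cplx R -> cplx R) (a z : cplx R) (s : R).

Lemma nested_intervals (l u : nat -> R) :
  (forall k, l k <= l k.+1) -> (forall k, u k.+1 <= u k) ->
  (forall k, l k <= u k) -> exists x, forall k, l k <= x <= u k.
Proof.
move=> lS uS lu.
have lm : {homo l : m n / (m <= n)%N >-> m <= n}.
  by apply/nondecreasing_seqP.
have um : {homo u : m n / (m <= n)%N >-> n <= m}.
  by apply/nonincreasing_seqP.
have lub m n : l m <= u n.
  apply: le_trans (lm _ _ (leq_maxl m n)) _.
  exact: le_trans (lu _) (um _ _ (leq_maxr m n)).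
exists (sup (range l)) => k; apply/andP; split.
  apply: ub_le_sup; last by exists k.
  by exists (u 0) => _ [n _ <-].
by apply: ge_sup => [|_ [n _ <-]//]; exists (l 0), 0%N.
Qed.

Lemma pow2_small (x e : R) : 0 < e -> exists k, forall n, (k <= n)%N -> x / 2 ^+ n < e.
Proof.
move=> e0; have [x0|x0] := lerP x 0.
  exists 0%N => n _; apply: le_lt_trans e0.
  by rewrite mulr_le0_ge0// invr_ge0 exprn_ge0.
exists (Num.trunc (x / e)).+1 => n kn.
rewrite ltr_pdivrMr ?exprn_gt0// mulrC -ltr_pdivrMr//.
apply: lt_le_trans (truncnS_gt _) _.
rewrite (@le_trans _ _ n%:R) ?ler_nat// -natrX ler_nat.
by rewrite ltnW// ltn_expl.
Qed.

(** Counting both half-open intervals gives 2 inside, 1 at the endpoints and 0 outside. Half-open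
    intervals make the count additive under halving, while it stays positive on the whole closed
    interval. *)
Let n1 (l s x : R) : R := (l <= x < l + s)%R%:R + (l < x <= l + s)%R%:R.

Lemma n1_half l s x : 0 < s -> n1 l s x = n1 l (s / 2) x + n1 (l + s / 2) (s / 2) x.
Proof.
move=> s0; rewrite /n1 (_ : l + s / 2 + s / 2 = l + s); last by field.
by case: (ltgtP l x) => h1; case: (ltgtP x (l + s)) => h2;
  case: (ltgtP x (l + s / 2)) => h3; rewrite ?(andbT, andbF)/=; lra.
Qed.

Lemma n1_ge0 l s x : 0 <= n1 l s x.
Proof. by rewrite addr_ge0. Qed.

Lemma n1_le2 l s x : n1 l s x <= 2.
Proof. by rewrite /n1; case: (_ && _); case: (_ && _) => /=; lra. Qed.

Lemma n1_ge1 l s x : 0 < s -> l <= x <= l + s -> 1 <= n1 l s x.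
Proof.
move=> s0 /andP[]; rewrite /n1; case: (ltgtP l x) => h1//; case: (ltgtP x (l + s)) => h2//=;
 lra.
Qed.

(* The closed square may contain one exceptional point z0, near which g is only bounded. The
   bisection compares contour sums with mu(Q) = e (s^2 + nu(Q)) instead of e s^2, where nu is
   additive under bisection and at least 1 on the closed squares that contain z0. *)
Lemma goursat g a s z0 (B d : R) : 0 < s -> 0 < d ->
  (forall p, square a s p -> p != z0 -> derivable g p 1) ->
  (forall z, modulus (z - z0) < d -> modulus (g z) <= B) ->
  forall e : R, 0 < e -> exists n0, forall n, (n0 <= n)%N ->
    modulus (sq_sum n g a s%:C%C) <= e.
Proof.
move=> s0 d0 dg gB e e0.
pose nu a s := n1 (complex.Re a) s (complex.Re z0) * n1 (complex.Im a) s (complex.Im z0).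
(* Since [nu] is at most 4, this normalization gives [mu a s <= e]. *)
pose e1 := e / (s ^+ 2 + 4).
have e10 : 0 < e1 by rewrite divr_gt0// ltr_wpDl ?sqr_ge0.
pose mu a s := e1 * (s ^+ 2 + nu a s).
pose good (q : cplx R * R) := exists n0, forall n, (n0 <= n)%N ->
  modulus (sq_sum n g q.1 q.2%:C%C) <= mu q.1 q.2.
have nu_ge0 b t : 0 <= nu b t by rewrite mulr_ge0// n1_ge0.
have [[n0 gn0]|bad0] := pselect (good (a, s)).
  exists n0 => n /gn0 /= /le_trans; apply.
  rewrite /mu /e1 mulrAC ler_pdivrMr ?ltr_wpDl ?sqr_ge0// ler_pM2l// lerD2l.
  by rewrite (le_trans (ler_pM _ _ (n1_le2 _ _ _) (n1_le2 _ _ _))) ?n1_ge0//; lra.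
exfalso.
(* A bad square has a bad quarter: if all four were good, [sq_sumS] and the additivity of [mu] would
   make the square good. In the impossible cases the square itself is returned as a dummy. *)
have step (q : cplx R * R) : exists q' : cplx R * R, 0 < q.2 -> ~ good q ->
    [/\ ~ good q', q'.2 = q.2 / 2,
      complex.Re q.1 <= complex.Re q'.1 <= complex.Re q.1 + q.2 / 2 &
      complex.Im q.1 <= complex.Im q'.1 <= complex.Im q.1 + q.2 / 2].
  case: q => b t.
  have [t0|] := ltrP 0 t; last by move=> t0; exists (b, t).
  pose h : cplx R := (t / 2)%:C%C.
  have [g1|n] := pselect (good (b, t / 2)); last first.
    by exists (b, t / 2) => _ _; split => //=; lra.
  have [g2|n] := pselect (good (b + h, t / 2)); last first.
    by exists (b + h, t / 2) => _ _; split => //=; case: (b) => b1 b2 /=; lra.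
  have [g3|n] := pselect (good (b + 'i%C * h, t / 2)); last first.
    by exists (b + 'i%C * h, t / 2) => _ _; split => //=; case: (b) => b1 b2 /=; lra.
  have [g4|n] := pselect (good (b + h + 'i%C * h, t / 2)); last first.
    by exists (b + h + 'i%C * h, t / 2) => _ _; split => //=; case: (b) => b1 b2 /=; lra.
  exists (b, t) => _ nb; exfalso; apply: nb.
  move: g1 g2 g3 g4 => [k1 g1] [k2 g2] [k3 g3] [k4 g4].
  (* The sum dominates the four thresholds; the successor pays for the level lost in passing to the
     quarters. *)
  exists (k1 + k2 + k3 + k4).+1 => -[//|n] kn /=.
  rewrite sq_sumS -real_complex_half -/h.
  have -> : mu b t = mu b (t/2) + mu (b + h) (t/2) + mu (b + 'i%C * h) (t/2)
      + mu (b + h + 'i%C * h) (t/2).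
    rewrite /mu /nu /h; case: (b) => b1 b2 /=.
    rewrite (n1_half b1 _ t0) (n1_half b2 _ t0) !(mul0r, mul1r, mulr0, addr0, subr0, add0r, oppr0).
    by field.
  rewrite (le_trans (modulusD _ _))// lerD//; last by apply: g4; lia.
  rewrite (le_trans (modulusD _ _))// lerD//; last by apply: g3; lia.
  by rewrite (le_trans (modulusD _ _))// lerD//; [apply: g1; lia|apply: g2; lia].
have [f fP] := choice step.
pose q k := iter k f (a, s).
have qP k : ~ good (q k) /\ (q k).2 = s / 2 ^+ k.
  elim: k => [|k [IH1 IH2]]; first by rewrite expr0 divr1.
  have [|h1 h2 _ _] := fP (q k) _ IH1; first by rewrite IH2 divr_gt0// exprn_gt0.
  by split => //; rewrite [LHS]h2 IH2 exprS invfM; field; rewrite expf_neq0.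
have q0 k : 0 < (q k).2 by rewrite (qP k).2 divr_gt0// exprn_gt0.
have [x xP] : exists x, forall k, complex.Re (q k).1 <= x <= complex.Re (q k).1 + (q k).2.
  apply: (@nested_intervals (fun k => complex.Re (q k).1)
     (fun k => complex.Re (q k).1 + (q k).2)) => k /=.
  - by have [_ _ + _] := fP (q k) (q0 k) (qP k).1; lra.
  - by have [_ -> + _] := fP (q k) (q0 k) (qP k).1; lra.
  - by rewrite lerDl ltW.
have [y yP] : exists y, forall k, complex.Im (q k).1 <= y <= complex.Im (q k).1 + (q k).2.
  apply: (@nested_intervals (fun k => complex.Im (q k).1)
     (fun k => complex.Im (q k).1 + (q k).2)) => k /=.
  - by have [_ _ _ +] := fP (q k) (q0 k) (qP k).1; lra.
  - by have [_ -> _ +] := fP (q k) (q0 k) (qP k).1; lra.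
  - by rewrite lerDl ltW.
pose p : cplx R := (x +i* y)%C.
have pq k : square (q k).1 (q k).2 p by [].
have bnd k (z : cplx R) : sq_boundary (q k).1 (q k).2%:C%C z -> modulus (z - p) <= 2 * (q k).2.
  move=> /sq_boundary_square zq; apply: square_dist (pq k).
  by apply: zq; rewrite ltW.
have mods k : modulus ((q k).2%:C%C : cplx R) = (q k).2.
  by rewrite modulus_real ger0_norm// ltW.
have small (r : R) : 0 < r -> exists k, (q k).2 < r.
  by move=> /(pow2_small s)[k /(_ k (leqnn _)) kP]; exists k; rewrite (qP k).2.
have [pz0|pz0] := eqVneq p z0.
(* The squares shrink to the exceptional point. The first bound keeps the contour in the disc where
   [g] is bounded, the second makes the sum at most [e1], and [e1] is at most [mu] because [nu] is
   at least 1 there. *)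
- pose r := Num.min (d / 2) (e1 / (4 * (`|B| + 1))).
  have B1 : 0 < `|B| + 1 by rewrite ltr_wpDl.
  have [|k kr] := small r.
    by rewrite lt_min; apply/andP; split; rewrite divr_gt0// mulr_gt0.
  have [krd kre] : (q k).2 < d / 2 /\ (q k).2 < e1 / (4 * (`|B| + 1)).
    by move: kr; rewrite lt_min => /andP[].
  apply: (qP k).1; exists 0%N => n _.
  apply: le_trans (sq_sum_bound n (B := `|B| + 1) _) _.
    move=> z /bnd; rewrite pz0 => zb; apply: (@le_trans _ _ B).
      by apply: gB; lra.
    by rewrite (le_trans (ler_norm _))// lerDl.
  rewrite mods mulrA; apply: (@le_trans _ _ e1).
    by rewrite mulrC -ler_pdivlMr ?mulr_gt0// ltW.
  rewrite /mu ler_pMr// ler_wpDl ?sqr_ge0//.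
  have [h1 h2] := pq k; move: h1 h2; rewrite pz0 => h1 h2.
  by rewrite -[leLHS]mul1r ler_pM//; apply: n1_ge1.
(* On the contour of a square of side [s] the distance to [p] is at most [2 * s], so the remainder
   contributes at most [4 * (e1 / 8 * (2 * s) * s)], that is [e1 * s ^+ 2]. *)
- have /derivable_modulusP[b /(_ (e1 / 8))] := dg p (pq 0%N) pz0.
  case=> [|r r0 rP]; first by rewrite divr_gt0.
  have [|k kr] := small (r / 2); first by rewrite divr_gt0.
  apply: (qP k).1; exists 0%N => n _.
  (* The first order expansion at [p] is affine and can be subtracted at no cost. *)
  have -> : sq_sum n g (q k).1 (q k).2%:C%C =
      sq_sum n (fun z => g z - g p - b * (z - p)) (q k).1 (q k).2%:C%C.
    rewrite -[LHS](@addrK _ 1) -[RHS](@addrK _ 1); congr (_ - _).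
    have -> : (fun z => g z - g p - b * (z - p)) =
       (fun z => 1 * g z + ((b * p - g p) + - b * z)).
      by apply/funext => z; ring.
    by rewrite sq_sum_lin sq_sum_affine mul1r addr0.
  apply: le_trans (sq_sum_bound n (B := e1 / 8 * (2 * (q k).2)) _) _.
    move=> z /bnd zb; apply: le_trans (rP _ _) _; first by lra.
    by rewrite ler_wpM2l// divr_ge0// ltW.
  rewrite mods /mu mulrDr.
  have -> : 4 * (e1 / 8 * (2 * (q k).2) * (q k).2) = e1 * (q k).2 ^+ 2 by field.
  by rewrite lerDl mulr_ge0// ltW.
Qed.
End Goursat.

(** * Cauchy's formula *)

Section CauchyFunctional.
Variable R : realType.
Implicit Types (f g h : cplx R -> cplx R) (a d z w : cplx R).

(** The increments of [G] between consecutive corners cancel around the square, which leaves the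
    four errors of [seg_sum_primitive]. *)
Lemma sq_sum_primitive n g (G : cplx R -> cplx R) a d (C : R) :
  (forall z w, sq_boundary a d z -> sq_boundary a d w ->
    modulus (G w - G z - g z * (w - z)) <= C * modulus (w - z) ^+ 2) ->
  modulus (sq_sum n g a d) <= 4 * (C * modulus d ^+ 2 / 2 ^+ n).
Proof.
move=> gG.
have H1 := seg_sum_primitive n (fun z w zs ws => gG z w (Or41 _ _ _ zs) (Or41 _ _ _ ws)).
have H2 := seg_sum_primitive n (fun z w zs ws => gG z w (Or42 _ _ _ zs) (Or42 _ _ _ ws)).
have H3 := seg_sum_primitive n (fun z w zs ws => gG z w (Or43 _ _ _ zs) (Or43 _ _ _ ws)).
have H4 := seg_sum_primitive n (fun z w zs ws => gG z w (Or44 _ _ _ zs) (Or44 _ _ _ ws)).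
move: H1 H2 H3 H4; rewrite !modulus_iM; set e := C * _ / _ => H1 H2 H3 H4.
have -> : 4 * e = e + e + e + e by ring.
apply: le_trans (lerD (lerD (lerD H1 H2) H3) H4).
rewrite /sq_sum (_ : a + 'i%C * d + d = a + d + 'i%C * d); last by ring.
set S1 := seg_sum _ _ _ _; set S2 := seg_sum _ _ _ _; set S3 := seg_sum _ _ _ _.
set S4 := seg_sum _ _ _ _.
set A := G a; set B := G (a + d); set D := G (a + 'i%C * d); set E := G (a + d + 'i%C * d).
have -> : S1 + S2 - S3 - S4 = (S1 - (B - A)) + (S2 - (E - B)) - (S3 - (E - D)) - (S4 - (D - A)).
  by ring.
by rewrite (le_trans (modulusB _ _))// lerD2r (le_trans (modulusB _ _))// lerD2r modulusD.
Qed.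

Lemma Im_half z : complex.Im (z / 2) = complex.Im z / 2.
Proof.
have -> : z / 2 = (2^-1)%:C%C * z by rewrite fmorphV rmorph_nat mulrC.
by case: z => x y /=; rewrite mul0r addr0 mulrC.
Qed.

(** The sum is an average of the values [g z * d], so a pointwise lower bound for them survives. *)
Lemma seg_sum_Im n g a d (u : cplx R) (c : R) :
  (forall z, segment a d z -> c <= complex.Im (u * (g z * d))) ->
  c <= complex.Im (u * seg_sum n g a d).
Proof.
elim: n a d c => [|n IHn] a d c H /=; first by apply: H; exact: segment_start.
have half z : complex.Im (u * (g z * (d / 2))) = complex.Im (u * (g z * d)) / 2.
  by rewrite !mulrA Im_half.
rewrite mulrDr [c]splitr.
have ImD z w : complex.Im (z + w) = complex.Im z + complex.Im w.
  by case: z w => ? ? [].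
rewrite ImD lerD// IHn// => z zs; rewrite half ler_pM2r// H//.
  exact: segment_left.
exact: segment_right.
Qed.

Lemma Im_mulV w z : z != 0 -> complex.Im (w * z^-1) =
  (complex.Im w * complex.Re z - complex.Re w * complex.Im z) / modulus z ^+ 2.
Proof.
rewrite -modulus_eq0 => z0; rewrite modulus_sqr.
case: z w z0 => x y [u v] _ /=; ring.
Qed.

Variables (z0 : cplx R) (rho : R).
Hypothesis rho0 : 0 < rho.

Let a : cplx R := z0 - (rho +i* rho)%C.
Let d : cplx R := (2 * rho)%:C%C.

Definition csquare : set (cplx R) := square a (2 * rho).
Definition cboundary : set (cplx R) := sq_boundary a d.

Lemma csquareP z : csquare z <->
  `|complex.Re (z - z0)| <= rho /\ `|complex.Im (z - z0)| <= rho.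
Proof.
rewrite /csquare /square /a !ler_norml.
by case: z z0 => x y [x0 y0] /=; split => -[h1 h2]; split; lra.
Qed.

Lemma csquare_disc z : modulus (z - z0) <= rho -> csquare z.
Proof.
move=> H; apply/csquareP; split.
  by rewrite (le_trans (Re_le_modulus _)).
by rewrite (le_trans (Im_le_modulus _)).
Qed.

Lemma cboundary_csquare z : cboundary z -> csquare z.
Proof. by apply: sq_boundary_square; rewrite mulr_ge0// ltW. Qed.

Lemma segment_coord b (t : cplx R) z : segment b t z -> exists2 s : R, 0 <= s <= 1 &
  (complex.Re z = complex.Re b + s * complex.Re t) /\
  (complex.Im z = complex.Im b + s * complex.Im t).
Proof.
move=> [s s01 ->]; exists s => //.
by case: b t => b1 b2 [t1 t2] /=; rewrite !mul0r subr0 addr0.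
Qed.

Lemma cboundary_far z : cboundary z -> rho <= modulus (z - z0).
Proof.
rewrite /cboundary /a /d => -[] /segment_coord[s s01 []].
- case: z z0 => x y [x0 y0] /= _; rewrite mulr0 addr0 => H.
  apply: le_trans (Im_le_modulus _); rewrite /= H ler_normr; apply/orP; right; lra.
- case: z z0 => x y [x0 y0] /= H _.
  apply: le_trans (Re_le_modulus _); rewrite /= H ler_normr; apply/orP; left; lra.
- case: z z0 => x y [x0 y0] /= _ H.
  apply: le_trans (Im_le_modulus _); rewrite /= H ler_normr; apply/orP; left; lra.
- case: z z0 => x y [x0 y0] /= H _.
  apply: le_trans (Re_le_modulus _); rewrite /= H ler_normr; apply/orP; right; lra.
Qed.

(** The discrete counterpart of $2\pi i$, by which the contour sums will be normalized. *)
Definition ckappa n := sq_sum n (fun z => (z - z0)^-1) a d.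

(** Every side contributes at least 1 to the imaginary part: with side vector [t] of length
    [2 * rho] at distance [rho] from [z0], the imaginary part of [t / (z - z0)] is
    [2 * rho ^+ 2 / modulus (z - z0) ^+ 2], and the denominator is at most [2 * rho ^+ 2]. *)
Lemma ckappa_ge n : 4 <= modulus (ckappa n).
Proof.
apply: le_trans (Im_le_modulus _); apply: le_trans (ler_norm _).
(* Here [t] is the side vector and [u] the sign with which the side enters the contour. *)
have key u z t : cboundary z ->
    2 * rho ^+ 2 <= complex.Im (u * t) * complex.Re (z - z0)
       - complex.Re (u * t) * complex.Im (z - z0) ->
    1 <= complex.Im (u * ((z - z0)^-1 * t)).
  move=> zb; have [h1 h2] := (csquareP z).1 (cboundary_csquare zb).
  have zz : 0 < modulus (z - z0) by apply: lt_le_trans rho0 (cboundary_far zb).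
  have -> : u * ((z - z0)^-1 * t) = (u * t) * (z - z0)^-1 by ring.
  rewrite Im_mulV -?modulus_gt0// ler_pdivlMr ?exprn_gt0// mul1r modulus_sqr.
  apply: le_trans; move: h1 h2; rewrite !ler_norml.
  by move: (complex.Re _) (complex.Im _) => x y h1 h2; nra.
have H1 : 1 <= complex.Im (1 * seg_sum n (fun z => (z - z0)^-1) a d).
  apply: seg_sum_Im => z zs; apply: key; first exact: Or41.
  move: zs => /segment_coord[s s01 []]; rewrite mul1r /d /a.
  case: z z0 => x y [x0 y0] /= _ ->; rewrite mulr0; nra.
have H2 : 1 <= complex.Im (1 * seg_sum n (fun z => (z - z0)^-1) (a + d) ('i%C * d)).
  apply: seg_sum_Im => z zs; apply: key; first exact: Or42.
  move: zs => /segment_coord[s s01 []]; rewrite mul1r /d /a.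
  case: z z0 => x y [x0 y0] /= -> _; nra.
have H3 : 1 <= complex.Im (-1 * seg_sum n (fun z => (z - z0)^-1) (a + 'i%C * d) d).
  apply: seg_sum_Im => z zs; apply: key; first exact: Or43.
  move: zs => /segment_coord[s s01 []]; rewrite mulN1r /d /a.
  case: z z0 => x y [x0 y0] /= _ ->; nra.
have H4 : 1 <= complex.Im (-1 * seg_sum n (fun z => (z - z0)^-1) a ('i%C * d)).
  apply: seg_sum_Im => z zs; apply: key; first exact: Or44.
  move: zs => /segment_coord[s s01 []]; rewrite mulN1r /d /a.
  case: z z0 => x y [x0 y0] /= -> _; nra.
move: H1 H2 H3 H4; rewrite /ckappa /sq_sum !mulN1r !mul1r.
move: (seg_sum _ _ _ _) (seg_sum _ _ _ _) (seg_sum _ _ _ _) (seg_sum _ _ _ _).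
by move=> [? ?] [? ?] [? ?] [? ?] /=; lra.
Qed.
End CauchyFunctional.

(** * The normalized contour functional and its Cauchy formula *)

Section CauchyFormula.
Variable R : realType.
Implicit Types (f g h k : cplx R -> cplx R) (z w : cplx R).

Lemma derivable_add f g z : derivable f z 1 -> derivable g z 1 ->
  derivable (fun w => f w + g w) z 1.
Proof. by move=> df dg; exact: (@derivableD _ _ _ f g). Qed.

Lemma derivable_mul f g z : derivable f z 1 -> derivable g z 1 ->
  derivable (fun w => f w * g w) z 1.
Proof. by move=> df dg; exact: (@derivableM _ _ f g). Qed.

Lemma derivable_const (c : cplx R) z : derivable (fun=> c : cplx R) z 1.
Proof. exact: derivable_cst. Qed.

Lemma derivable_subr (z w : cplx R) : derivable (fun p => p - z) w 1.
Proof. apply: derivable_add; [exact: derivable_id|exact: derivable_const]. Qed.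

Lemma derivable_inv f z : f z != 0 -> derivable f z 1 ->
  derivable (fun w => (f w)^-1) z 1.
Proof. by move=> fz df; exact: (@derivableV _ _ f). Qed.

Lemma modulus_div z w (A m : R) : 0 < m -> modulus z <= A -> m <= modulus w ->
  modulus (z / w) <= A / m.
Proof.
move=> m0 zA mw; rewrite modulusM modulusV ler_pM ?modulus_ge0 ?invr_ge0 ?modulus_ge0//.
by rewrite lef_pV2// posrE// (lt_le_trans m0).
Qed.

(** Provides the bound that [goursat] asks for near its exceptional point, including the point
    itself, where the quotient evaluates to 0. *)
Lemma derivable_bounded_quotient f z : derivable f z 1 ->
  exists B d, 0 < d /\ forall w, modulus (w - z) < d -> modulus ((f w - f z) / (w - z)) <= B.
Proof.
move=> /derivable_modulusP[b /(_ 1 ltr01)[d d0 dP]].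
exists (modulus b + 1), d; split => // w wd.
have [->|wz] := eqVneq w z.
  by rewrite !subrr mul0r modulus0 addr_ge0 ?modulus_ge0.
have wz0 : 0 < modulus (w - z) by rewrite modulus_gt0 subr_eq0.
rewrite modulusM modulusV ler_pdivrMr// mulrDl mul1r.
rewrite -[f w - f z](subrK (b * (w - z))) (le_trans (modulusD _ _))// addrC lerD//.
  by rewrite modulusM.
by have := dP w wd; rewrite mul1r.
Qed.

Lemma derivable_quotient f z p : p != z -> derivable f p 1 ->
  derivable (fun w => (f w - f z) / (w - z)) p 1.
Proof.
move=> pz fp; apply: derivable_mul.
  apply: derivable_add; [exact: fp|exact: derivable_const].
apply: derivable_inv; [by rewrite subr_eq0|exact: derivable_subr].
Qed.

(** [Lam] stands for $\frac{1}{2\pi i}\oint$. The first clause combines linearity with dependence on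
    the boundary values alone; [B] and [B'] only express boundedness. The constant [2 * rho] is the
    perimeter [8 * rho] divided by the lower bound 4 of [ckappa_ge]. *)
Definition cauchy_functional z0 (rho : R) (Lam : (cplx R -> cplx R) -> cplx R) : Prop :=
  [/\ (forall (c : cplx R) g h k (B B' : R),
        (forall z, cboundary z0 rho z -> modulus (g z) <= B) ->
        (forall z, cboundary z0 rho z -> modulus (h z) <= B') ->
        (forall z, cboundary z0 rho z -> k z = c * g z + h z) ->
        Lam k = c * Lam g + Lam h),
      (forall g (B : R), (forall z, cboundary z0 rho z -> modulus (g z) <= B) ->
        modulus (Lam g) <= 2 * rho * B)
    & (forall f (B : R) z, (forall w, csquare z0 rho w -> derivable f w 1) ->
        (forall w, cboundary z0 rho w -> modulus (f w) <= B) ->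
        modulus (z - z0) < rho -> Lam (fun w => f w / (w - z)) = f z)].

Lemma subdivide_small (phi : cplx R -> cplx R) z0 (r C : R) : 0 <= r ->
  (forall z w, modulus (z - z0) <= r -> modulus (w - z0) <= r ->
    modulus (phi w - phi z) <= C * modulus (w - z) ^+ 2) ->
  forall z, modulus (z - z0) <= r -> phi z = phi z0.
Proof.
move=> r0 H z zr.
pose v := z - z0.
have C0 : 0 <= C * modulus v ^+ 2.
  apply: le_trans (modulus_ge0 _) (H z0 z _ zr).
  by rewrite subrr modulus0.
have step (m : nat) (j : nat) : (j <= m.+1)%N ->
    modulus (phi (z0 + j%:R / m.+1%:R * v) - phi z0) <= j%:R * (C * (modulus v / m.+1%:R) ^+ 2).
  elim: j => [|j IHj] jm; first by rewrite !mul0r addr0 subrr modulus0.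
  have m0 : 0 < m.+1%:R :> R by rewrite ltr0n.
  have near_z0 (i : nat) : (i <= m.+1)%N -> modulus (z0 + i%:R / m.+1%:R * v - z0) <= r.
    move=> im; rewrite addrAC subrr add0r !modulusM modulusV !modulus_nat.
    apply: le_trans zr; rewrite ler_piMl ?modulus_ge0// ler_pdivrMr// mul1r ler_nat//.
  rewrite -[phi (z0 + j.+1%:R / _ * _)](subrK (phi (z0 + j%:R / m.+1%:R * v))) -addrA.
  apply: le_trans (modulusD _ _) _.
  rewrite -[in leRHS]natr1 mulrDl mul1r [leRHS]addrC lerD//; last by rewrite IHj// ltnW.
  apply: le_trans (H _ _ _ _) _; [exact/near_z0/ltnW|exact: near_z0|].
  rewrite le_eqVlt; apply/orP; left; apply/eqP; congr (_ * _ ^+ 2).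
  have -> : z0 + j.+1%:R / m.+1%:R * v - (z0 + j%:R / m.+1%:R * v) = m.+1%:R^-1 * v.
    by rewrite -[j.+1%:R]natr1; ring.
  by rewrite modulusM modulusV modulus_nat mulrC.
apply: eq_modulus_small => e e0.
pose m := Num.trunc (C * modulus v ^+ 2 / e).
have := step m m.+1 (leqnn _); rewrite divff ?pnatr_eq0// mul1r.
rewrite (_ : z0 + v = z); last by rewrite /v addrC subrK.
move=> /le_lt_trans; apply.
have m0 : 0 < m.+1%:R :> R by rewrite ltr0n.
rewrite (_ : _ * _ = C * modulus v ^+ 2 / m.+1%:R); last by rewrite /v; field; rewrite lt0r_neq0.
by rewrite ltr_pdivrMr// [ltRHS]mulrC -ltr_pdivrMr// truncnS_gt.
Qed.

(** Write [f w / (w - z)] as [f z / (w - z)] plus a difference quotient. Goursat's lemma with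
    exceptional point [z] kills the quotient. The remaining factor [phi z] is 1: it is constant in
    [z] because its formal derivative vanishes, and it is 1 at [z0] by the normalization. *)
Lemma cauchy_functional_exists z0 (rho : R) : 0 < rho -> exists Lam, cauchy_functional z0 rho Lam.
Proof.
move=> rho0; have [L [LD LZ Lc Lb]] := generalized_limit_exists R.
pose a : cplx R := z0 - (rho +i* rho)%C.
pose d : cplx R := (2 * rho)%:C%C.
pose K := ckappa z0 rho.
have K0 n : 0 < modulus (K n) by apply: lt_le_trans (ckappa_ge z0 rho0 n).
pose S g n := sq_sum n g a d / K n.
pose bnd g (B : R) := forall z, cboundary z0 rho z -> modulus (g z) <= B.
have md : modulus d = 2 * rho by rewrite modulus_real ger0_norm// mulr_ge0// ltW.
have SB g (B : R) n : bnd g B -> modulus (S g n) <= 2 * rho * B.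
  move=> gB; apply: le_trans (modulus_div _ (sq_sum_bound n gB) (ckappa_ge z0 rho0 n)) _ => //.
  by rewrite md; lra.
have bS g (B : R) : bnd g B -> bounded_seq (S g) by move=> gB; exists (2 * rho * B) => n; exact: SB.
pose Lam g := L (S g).
have Llin (c : cplx R) g h k (B B' : R) : bnd g B -> bnd h B' ->
    (forall z, cboundary z0 rho z -> k z = c * g z + h z) -> Lam k = c * Lam g + Lam h.
  move=> gB hB kgh; rewrite /Lam -LZ; last exact: bS gB.
  rewrite -LD; [|by case: (bS _ _ gB) => M MP; exists (modulus c * M) => n;
     rewrite modulusM ler_wpM2l ?modulus_ge0|exact: bS hB].
  congr L; apply/funext => n; rewrite /S (eq_sq_sum n kgh) sq_sum_lin; ring.
have Lbound g (B : R) : bnd g B -> modulus (Lam g) <= 2 * rho * B.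
  by move=> gB; apply: (Lb _ _ 0%N) (bS _ _ gB) _ => n _; exact: SB.
have Lvanish g (B : R) : bnd g B ->
    (forall e : R, 0 < e -> exists n0, forall n, (n0 <= n)%N -> modulus (sq_sum n g a d) <= e) ->
    Lam g = 0.
  move=> gB g0; apply: eq_modulus_small => e e0; rewrite subr0.
  have [n0 n0P] := g0 e e0.
  have : modulus (Lam g) <= e / 4.
    by apply: (Lb _ _ n0) (bS _ _ gB) _ => n /n0P h; apply: modulus_div (ckappa_ge z0 rho0 n).
  lra.
have Lscale (c : cplx R) g (B : R) : bnd g B -> Lam (fun z => c * g z) = c * Lam g.
  move=> gB; have z0b : bnd (fun=> 0) 0 by move=> z _; rewrite modulus0.
  rewrite (Llin c _ _ _ _ _ gB z0b) => [|z _]; last by rewrite addr0.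
  suff -> : Lam (fun=> 0) = 0 by rewrite addr0.
  by apply: (Lvanish _ _ z0b) => e e0; exists 0%N => n _; have := sq_sum_bound n z0b;
    rewrite mul0r mulr0 => /le_trans; apply; exact: ltW.
have far z w : cboundary z0 rho w -> rho - modulus (z - z0) <= modulus (w - z).
  move=> /cboundary_far wr; rewrite lerBlDr (le_trans wr)//.
  rewrite (_ : w - z0 = (w - z) + (z - z0)); [exact: modulusD|ring].
have near0 z : modulus (z - z0) < rho -> 0 < rho - modulus (z - z0) by rewrite subr_gt0.
have neq0 z w : modulus (z - z0) < rho -> cboundary z0 rho w -> w - z != 0.
  move=> zr wb; rewrite -modulus_gt0; exact: lt_le_trans (near0 _ zr) (far _ _ wb).
pose phi z := Lam (fun w => (w - z)^-1).
have bV z : modulus (z - z0) < rho -> bnd (fun w => (w - z)^-1) (rho - modulus (z - z0))^-1.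
  by move=> zr w wb; rewrite -[(w - z)^-1]mul1r -[leRHS]mul1r modulus_div ?near0 ?modulus1 ?far.
have bV2 z : modulus (z - z0) < rho ->
    bnd (fun w => (w - z)^-1 ^+ 2) ((rho - modulus (z - z0))^-1 ^+ 2).
  move=> zr w wb; rewrite modulusX lerXn2r ?nnegrE ?modulus_ge0 ?invr_ge0//; last exact: bV.
  by rewrite ltW// near0.
(* The function has the primitive [- (w - z)^-1], with a quadratic error that is uniform on the
   contour. *)
have phi2 z : modulus (z - z0) < rho -> Lam (fun w => (w - z)^-1 ^+ 2) = 0.
  move=> zr; apply: Lvanish (bV2 _ zr) _ => e e0.
  pose m := rho - modulus (z - z0); have m0 : 0 < m by exact: near0.
  pose C := (m^-1) ^+ 3.
  have H n := @sq_sum_primitive R n (fun w => (w - z)^-1 ^+ 2) (fun w => - (w - z)^-1) a d C.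
  have [n0 n0P] := pow2_small (4 * (C * modulus d ^+ 2)) e0.
  exists n0 => n /n0P/ltW; apply: le_trans; rewrite -mulrA; apply: H => w w' wb w'b.
  have wz := neq0 _ _ zr wb; have w'z := neq0 _ _ zr w'b.
  have -> : - (w' - z)^-1 - - (w - z)^-1 - (w - z)^-1 ^+ 2 * (w' - w) =
     (w' - z)^-1 * (w - z)^-1 ^+ 2 * - (w' - w) ^+ 2 by field; rewrite wz w'z.
  rewrite !modulusM modulusN !modulusX ler_wpM2r ?exprn_ge0 ?modulus_ge0// /C [m^-1 ^+ 3]exprS.
  apply: ler_pM; rewrite ?mulr_ge0 ?modulus_ge0 ?bV// -modulusM; exact: bV2.
have phi1 z : modulus (z - z0) < rho -> phi z = 1.
  move=> zr.
  have -> : phi z = phi z0.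
    pose m := rho - modulus (z - z0); have m0 : 0 < m by exact: near0.
    apply: (@subdivide_small phi z0 (modulus (z - z0)) (2 * rho * (m^-1) ^+ 3)) => //.
      exact: modulus_ge0.
    move=> u w uz wz.
    have ur := le_lt_trans uz zr; have wr := le_lt_trans wz zr.
    have b3 : bnd (fun x => (x - u)^-1 ^+ 2 * (x - w)^-1) ((m^-1) ^+ 3).
      have mV v : modulus (v - z0) <= modulus (z - z0) -> modulus (v - z0) < rho ->
          (rho - modulus (v - z0))^-1 <= m^-1.
        by move=> vz vr; rewrite lef_pV2 ?posrE ?near0// lerD2l lerN2.
      move=> x xb; rewrite modulusM modulusX [m^-1 ^+ 3]exprSr.
      apply: ler_pM; rewrite ?exprn_ge0 ?modulus_ge0//.
        rewrite lerXn2r ?nnegrE ?modulus_ge0 ?invr_ge0 ?(ltW m0)//.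
        by rewrite (le_trans (bV _ ur _ xb))// mV.
      by rewrite (le_trans (bV _ wr _ xb))// mV.
    (* Expand [(x - w)^-1] to second order at [u]; the first order term [(w - u) * (x - u)^-1 ^+ 2]
       is killed by [phi2]. *)
    have -> : phi w = 1 * phi u + (w - u) ^+ 2 * Lam (fun x => (x - u)^-1 ^+ 2 * (x - w)^-1).
      have b2 := bV2 _ ur.
      have b2' : bnd (fun x => (w - u) * (x - u)^-1 ^+ 2)
          (modulus (w - u) * (rho - modulus (u - z0))^-1 ^+ 2).
        by move=> x xb; rewrite modulusM ler_wpM2l ?modulus_ge0// b2.
      have b3' : bnd (fun x => (x - w)^-1 - (x - u)^-1)
          ((rho - modulus (w - z0))^-1 + (rho - modulus (u - z0))^-1).
        by move=> x xb; rewrite (le_trans (modulusB _ _))// lerD ?bV.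
      rewrite [phi w](Llin 1 _ _ (fun x => (x - w)^-1) _ _ (bV _ ur) b3') => [|x _ /=];
        last by rewrite mul1r [RHS]addrC subrK.
      congr (_ + _).
      rewrite (Llin ((w - u) ^+ 2) _ _ (fun x => (x - w)^-1 - (x - u)^-1) _ _ b3 b2')
        => [|x xb /=]; last first.
        have := neq0 _ _ ur xb; have := neq0 _ _ wr xb => xw xu.
        by field; rewrite xw xu.
      by rewrite (Lscale _ _ _ b2) phi2// mulr0 addr0.
    rewrite mul1r addrAC subrr add0r modulusM modulusX mulrC ler_wpM2r ?exprn_ge0 ?modulus_ge0//.
    by apply: Lbound.
  (* At [z0] the contour sum is [K n] itself, so the normalized sums are constantly 1. *)
  rewrite /phi /Lam (_ : S _ = fun=> 1) ?Lc//; apply/funext => n.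
  by rewrite /S; apply: divff; rewrite -modulus_gt0; exact: K0.
exists Lam; split => // f B z fd fB zr.
have fz : derivable f z 1 by apply: fd; apply: csquare_disc => //; exact: ltW.
have bq : bnd (fun w => (f w - f z) / (w - z)) ((B + modulus (f z)) / (rho - modulus (z - z0))).
  move=> w wb; apply: modulus_div; [exact: near0| |exact: far].
  by rewrite (le_trans (modulusB _ _))// lerD2r fB.
have q0 : Lam (fun w => (f w - f z) / (w - z)) = 0.
  apply: Lvanish bq _; have [Bd [r [r0 rP]]] := derivable_bounded_quotient fz.
  apply: (goursat _ r0 _ rP); first by rewrite mulr_gt0.
  move=> p ps pz; apply: derivable_quotient; [exact: pz|exact: fd].
rewrite (Llin (f z) (fun w => (w - z)^-1) (fun w => (f w - f z) / (w - z)) _ _ _ (bV _ zr) bq).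
  by rewrite q0 addr0 -/(phi z) phi1// mulr1.
by move=> w wb /=; rewrite mulrBl [RHS]addrC subrK.
Qed.
End CauchyFormula.

(** * Local theory of holomorphic functions *)

Section LocalTheory.
Variable R : realType.
Implicit Types (f g h u : cplx R -> cplx R) (z w : cplx R) (Omega : set (cplx R)).

Lemma derivable_quadratic f z (b : cplx R) (C r : R) : 0 < r ->
  (forall w, modulus (w - z) <= r ->
    modulus (f w - f z - b * (w - z)) <= C * modulus (w - z) ^+ 2) ->
  derivable f z 1.
Proof.
move=> r0 H; apply/derivable_modulusP; exists b => e e0.
have C1 : 0 < `|C| + 1 by rewrite ltr_wpDl.
exists (Num.min r (e / (`|C| + 1))).
  by rewrite lt_min r0 divr_gt0.
move=> w; rewrite lt_min => /andP[wr we].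
apply: le_trans (H w (ltW wr)) _; rewrite expr2 mulrA ler_wpM2r ?modulus_ge0//.
apply: (@le_trans _ _ ((`|C| + 1) * modulus (w - z))).
  by rewrite ler_wpM2r ?modulus_ge0// (le_trans (ler_norm _))// lerDl.
by rewrite mulrC -ler_pdivlMr// ltW.
Qed.

Lemma derivable_local f g z (r : R) : 0 < r ->
  (forall w, modulus (w - z) < r -> f w = g w) ->
  derivable g z 1 -> derivable f z 1.
Proof.
move=> r0 fg /derivable_modulusP[b bP]; apply/derivable_modulusP; exists b => e e0.
have [d d0 dP] := bP e e0; exists (Num.min r d); first by rewrite lt_min r0.
move=> w; rewrite lt_min => /andP[wr wd]; rewrite !fg ?subrr ?modulus0//.
exact: dP.
Qed.

Lemma derivable_continuity f z : derivable f z 1 ->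
  forall e : R, 0 < e -> exists2 d : R, 0 < d &
    forall w, modulus (w - z) < d -> modulus (f w - f z) <= e.
Proof.
move=> /derivable_bounded_quotient[B [d [d0 dB]]] e e0.
have B1 : 0 < `|B| + 1 by rewrite ltr_wpDl.
exists (Num.min d (e / (`|B| + 1))); first by rewrite lt_min d0 divr_gt0.
move=> w; rewrite lt_min => /andP[wd we].
have [->|wz] := eqVneq w z; first by rewrite subrr modulus0 ltW.
have wz0 : 0 < modulus (w - z) by rewrite modulus_gt0 subr_eq0.
have := dB w wd; rewrite modulusM modulusV ler_pdivrMr// => /le_trans; apply.
apply: (@le_trans _ _ ((`|B| + 1) * modulus (w - z))).
  by rewrite ler_wpM2r ?modulus_ge0// (le_trans (ler_norm _))// lerDl.
by rewrite mulrC -ler_pdivlMr// ltW.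
Qed.

Lemma open_csquare Omega z : open Omega -> Omega z ->
  exists2 rho : R, 0 < rho & csquare z rho `<=` Omega.
Proof.
move=> oO Oz; have [r r0 rP] := open_modulusP oO Oz.
exists (r / 3); first by rewrite divr_gt0.
move=> w /csquareP[h1 h2]; apply: rP; apply: le_lt_trans (modulus_le_ReIm _) _.
by move: h1 h2; move: `|_| `|_| => x y; lra.
Qed.

(* [F k] is the k-th iterated divided difference of f at z0, so that [F k z0] is its k-th Taylor
   coefficient. *)
Lemma taylor f z0 (rho M : R) : 0 < rho ->
  (forall w, csquare z0 rho w -> derivable f w 1) ->
  (forall w, csquare z0 rho w -> modulus (f w) <= M) ->
  exists F : nat -> cplx R -> cplx R, forall z, modulus (z - z0) <= rho / 2 ->
    [/\ F 0%N z = f z,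
        forall k, F k z = F k z0 + (z - z0) * F k.+1 z
      & forall k, modulus (F k z) <= 4 * M / rho ^+ k].
Proof.
move=> rho0 df fM; have [Lam [lin bound cauchy]] := cauchy_functional_exists z0 rho0.
(* The recurrence comes from $\frac{1}{w-z}=\frac{1}{w-z_0}+\frac{z-z_0}{(w-z_0)(w-z)}$. On the
   contour [w] is at distance at least [rho] from [z0] and [rho / 2] from [z], whence the bound
   [2 * rho * (M / rho ^+ k / (rho / 2))]. *)
exists (fun k z => Lam (fun w => f w / (w - z0) ^+ k / (w - z))) => z zr.
have fb w : cboundary z0 rho w -> modulus (f w) <= M.
  by move=> wb; apply: fM; exact: cboundary_csquare.
have M0 : 0 <= M.
  by apply: le_trans (modulus_ge0 _) (fM z0 _); apply: csquare_disc; rewrite // subrr modulus0 ltW.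
have far v w : modulus (v - z0) <= rho / 2 -> cboundary z0 rho w -> rho / 2 <= modulus (w - v).
  move=> vr /cboundary_far wr; have := modulus_triangle (w - z0) (v - z0).
  by rewrite (_ : w - z0 - (v - z0) = w - v); [lra|ring].
have Fb k v w : modulus (v - z0) <= rho / 2 -> cboundary z0 rho w ->
    modulus (f w / (w - z0) ^+ k / (w - v)) <= M / rho ^+ k / (rho / 2).
  move=> vr wb; apply: modulus_div; [by rewrite divr_gt0| |exact: far].
  apply: modulus_div; [by rewrite exprn_gt0|exact: fb|].
  by rewrite modulusX lerXn2r ?nnegrE ?modulus_ge0 ?(ltW rho0)// cboundary_far.
have z0r : modulus (z0 - z0) <= rho / 2 by rewrite subrr modulus0 divr_ge0// ltW.
split.
- have -> : (fun w => f w / (w - z0) ^+ 0 / (w - z)) = (fun w => f w / (w - z)).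
    by apply/funext => w; rewrite expr0 divr1.
  by apply: (cauchy f M); [exact: df|exact: fb|lra].
- move=> k; rewrite addrC.
  apply: (lin (z - z0) _ _ _ _ _ (fun w => @Fb k.+1 z w zr) (fun w => @Fb k z0 w z0r)).
  move=> w wb /=.
  have wz : w - z != 0 by rewrite -modulus_gt0; apply: lt_le_trans (far _ _ zr wb);
    rewrite divr_gt0.
  have wz0 : w - z0 != 0 by rewrite -modulus_gt0; apply: lt_le_trans (far _ _ z0r wb);
    rewrite divr_gt0.
  have : (w - z0) ^+ k != 0 by rewrite expf_neq0.
  rewrite exprS; move: (_ ^+ k) => x x0; field; by rewrite wz wz0 x0.
- move=> k; apply: le_trans (bound _ _ (fun w => @Fb k z w zr)) _.
  have : rho ^+ k != 0 by rewrite expf_neq0// lt0r_neq0.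
  move: (rho ^+ k) => x x0; rewrite le_eqVlt; apply/orP; left; apply/eqP; field.
  by rewrite x0 lt0r_neq0.
Qed.

(** [L] passes through the expansion of [fs n] at [z0] with remainder of order 2; the bounds from
    [taylor] depend only on [M] and [rho], so the remainder stays quadratic in the limit. *)
Lemma generalized_limit_holomorphic (L : (nat -> cplx R) -> cplx R) Omega
    (fs : nat -> cplx R -> cplx R) (M : R) : generalized_limit L -> open Omega ->
  (forall n, holomorphic_on Omega (fs n)) ->
  (forall n z, Omega z -> modulus (fs n z) <= M) ->
  holomorphic_on Omega (fun z => L (fun n => fs n z)).
Proof.
move=> [LD LZ Lc Lb] oO df fM z0 Oz0.
have [rho rho0 rhoO] := open_csquare oO Oz0.
have /choice[F FP] : forall n, exists F : nat -> cplx R -> cplx R, forall z,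
    modulus (z - z0) <= rho / 2 ->
    [/\ F 0%N z = fs n z, forall k, F k z = F k z0 + (z - z0) * F k.+1 z
      & forall k, modulus (F k z) <= 4 * M / rho ^+ k].
  by move=> n; apply: taylor => // w /rhoO Ow; [exact: df|exact: fM].
have z0r : modulus (z0 - z0) <= rho / 2 by rewrite subrr modulus0 divr_ge0// ltW.
have Fb k z : modulus (z - z0) <= rho / 2 -> bounded_seq (fun n => F n k z).
  by move=> zr; exists (4 * M / rho ^+ k) => n; have [_ _] := FP n z zr; apply.
apply: (@derivable_quadratic _ z0 (L (fun n => F n 1%N z0)) (4 * M / rho ^+ 2) (rho / 2)).
  by rewrite divr_gt0.
move=> z zr.
have scaled (c : cplx R) x : bounded_seq x -> bounded_seq (fun n => c * x n).
  by move=> [B xB]; exists (modulus c * B) => n; rewrite modulusM ler_wpM2l ?modulus_ge0.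
have LF k : L (fun n => F n k z) = L (fun n => F n k z0) + (z - z0) * L (fun n => F n k.+1 z).
  rewrite -LZ; last exact: Fb.
  rewrite -LD; [|exact: Fb|by apply: scaled; exact: Fb].
  by congr L; apply/funext => n; have [_ + _] := FP n z zr; apply.
have F0 v : modulus (v - z0) <= rho / 2 -> L (fun n => fs n v) = L (fun n => F n 0%N v).
  by move=> vr; congr L; apply/funext => n; have [-> _ _] := FP n v vr.
rewrite (F0 _ zr) (F0 _ z0r) (LF 0%N) (LF 1%N).
rewrite (_ : _ - _ - _ = (z - z0) ^+ 2 * L (fun n => F n 2%N z)); last by ring.
rewrite modulusM modulusX mulrC ler_wpM2r ?exprn_ge0 ?modulus_ge0//.
by apply: (Lb _ _ 0%N (Fb _ _ zr)) => n _; have [_ _] := FP n z zr; apply.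
Qed.

(** The exponent [n] is the index of the first nonzero Taylor coefficient. If there is none, [f z]
    equals [(z - z0) ^+ n * F n z] for all [n], which is at most [4 * M / 2 ^+ n] on the half
    disc. *)
Lemma zero_factorization Omega f (M : R) z0 : open Omega -> holomorphic_on Omega f ->
  (forall z, Omega z -> modulus (f z) <= M) -> Omega z0 ->
  (exists2 r : R, 0 < r & forall z, modulus (z - z0) < r -> f z = 0) \/
  (exists n h, [/\ holomorphic_on Omega h, h z0 != 0
    & forall z, Omega z -> f z = (z - z0) ^+ n * h z]).
Proof.
move=> oO df fM Oz0; have [rho rho0 rhoO] := open_csquare oO Oz0.
have [|w /rhoO Ow|F FP] := @taylor f z0 rho M rho0; first by move=> w /rhoO; exact: df.
  exact: fM.
have r20 : 0 < rho / 2 by rewrite divr_gt0.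
have z0r : modulus (z0 - z0) <= rho / 2 by rewrite subrr modulus0 ltW.
have fF n : (forall k, (k < n)%N -> F k z0 = 0) -> forall z, modulus (z - z0) <= rho / 2 ->
    f z = (z - z0) ^+ n * F n z.
  elim: n => [|n IHn] H z zr; first by have [-> _ _] := FP z zr; rewrite mul1r.
  rewrite IHn//; last by move=> k kn; apply: H; exact: ltnW.
  by have [_ -> _] := FP z zr; rewrite H// add0r mulrA -exprSr.
have [all0|/existsNP[n0 Fn0]] := pselect (forall k, F k z0 = 0).
  left; exists (rho / 2) => // z zr; apply: eq_modulus_small => e e0; rewrite subr0.
  have [n /(_ n (leqnn _)) nP] := pow2_small (4 * M) e0.
  apply: le_lt_trans nP; rewrite (fF n)//; last exact: ltW.
  have [_ _ /(_ n) FB] := FP z (ltW zr).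
  rewrite modulusM modulusX.
  apply: (@le_trans _ _ ((rho / 2) ^+ n * (4 * M / rho ^+ n))).
    by rewrite ler_pM ?exprn_ge0 ?modulus_ge0// lerXn2r ?nnegrE ?modulus_ge0// ltW.
  rewrite exprMn exprVn; have : rho ^+ n != 0 by rewrite expf_neq0// lt0r_neq0.
  have : 2 ^+ n != 0 :> R by rewrite expf_neq0.
  move: (rho ^+ n) (2 ^+ n) => x y y0 x0; rewrite le_eqVlt; apply/orP; left; apply/eqP; field.
  by rewrite x0 y0.
right; have exn : exists n, F n z0 != 0 by exists n0; apply/eqP.
case: (ex_minnP exn) => n Fn nmin.
have Fk k : (k < n)%N -> F k z0 = 0.
  by move=> kn; apply/eqP; apply: contraTT kn => /nmin; rewrite -leqNgt.
(* The quotient is defined on all of [Omega], whereas [F n] is controlled only near [z0]; there the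
   two agree, and two further terms of the expansion give the derivative of [h] at [z0]. *)
pose h z := if z == z0 then F n z0 else f z / (z - z0) ^+ n.
have hF z : modulus (z - z0) <= rho / 2 -> h z = F n z.
  move=> zr; rewrite /h; case: eqP => [->//|/eqP zz0].
  by rewrite (fF n)// mulrAC divff ?mul1r// expf_neq0// subr_eq0.
exists n, h; split; [|by rewrite /h eqxx|].
- move=> z Oz; have [->|zz0] := eqVneq z z0.
    apply: (@derivable_quadratic _ z0 (F n.+1 z0) (4 * M / rho ^+ n.+2) (rho / 2)) => //.
    move=> w wr; rewrite !hF//; have [_ Fw FB] := FP w wr.
    rewrite (Fw n) (Fw n.+1).
    rewrite (_ : _ - _ - _ = (w - z0) ^+ 2 * F n.+2 w); last by ring.
    by rewrite modulusM modulusX mulrC ler_wpM2r ?exprn_ge0 ?modulus_ge0.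
  apply: (@derivable_local _ (fun z => f z * ((z - z0) ^+ n)^-1) _ (modulus (z - z0))).
  + by rewrite modulus_gt0 subr_eq0.
  + move=> w; rewrite /h; case: eqP => // ->.
    by rewrite modulus_distC ltxx.
  + apply: derivable_mul; first exact: df.
    apply: derivable_inv; first by rewrite expf_neq0// subr_eq0.
    by elim: (n) => [|m IHm]; [rewrite (_ : (fun _ => _) = fun=> 1); [exact: derivable_const|
      by apply/funext => w; rewrite expr0]|rewrite (_ : (fun _ => _) =
      fun w => (w - z0) * (w - z0) ^+ m); [apply: derivable_mul; [exact: derivable_subr|exact: IHm]|
      by apply/funext => w; rewrite exprS]].
- move=> z Oz; have [->|zz0] := eqVneq z z0.
    by rewrite hF// -fF.
  by rewrite /h (negbTE zz0) mulrC divfK// expf_neq0// subr_eq0.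
Qed.

(** The set [A] of points near which [f] vanishes identically is open, and closed relative to
    [Omega] because a zero of finite order is isolated. *)
Lemma identity_theorem Omega f (M : R) z1 : open Omega -> connected Omega ->
  holomorphic_on Omega f -> (forall z, Omega z -> modulus (f z) <= M) -> Omega z1 ->
  (exists2 r : R, 0 < r & forall z, modulus (z - z1) < r -> f z = 0) ->
  forall z, Omega z -> f z = 0.
Proof.
move=> oO cO df fM Oz1 f1.
pose A : set (cplx R) := [set p | exists2 r : R, 0 < r & forall z, modulus (z - p) < r -> f z = 0].
have AO : Omega `&` A = Omega.
  apply: cO; first by exists z1.
    exists A => //; rewrite openE => p [r r0 rP]; apply/nbhs_modulusP.
    exists (r / 2); first by rewrite divr_gt0.
    move=> w wp; exists (r / 2); first by rewrite divr_gt0.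
    move=> z zw; apply: rP; rewrite (_ : z - p = (z - w) + (w - p)); last by ring.
    by apply: le_lt_trans (modulusD _ _) _; lra.
  exists (closure A); first exact: closed_closure.
  apply/seteqP; split => [z [Oz Az]|z [Oz cAz]]; split => //; first exact: subset_closure.
  (* If [z] were a limit point of [A] outside [A], some [p] in [A] close to [z] and distinct from it
     would give [h p = 0], although [h] is close to [h z] there. *)
  have [//|[n [h [dh hz fh]]]] := zero_factorization oO df fM Oz.
  have [nA|nA] := pselect (A z); first by [].
  exfalso; have hz0 : 0 < modulus (h z) / 2 by rewrite divr_gt0// modulus_gt0.
  have [d d0 dP] := derivable_continuity (dh z Oz) hz0.
  have [r r0 rP] := open_modulusP oO Oz.
  have [p [Ap pr]] : A `&` [set w | modulus (w - z) < Num.min r d] !=set0.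
    by apply: cAz; apply/nbhs_modulusP; exists (Num.min r d); rewrite // lt_min r0.
  have pz : p != z by apply/eqP => pz; apply: nA; rewrite -pz.
  move: pr; rewrite /= lt_min => /andP[pr pd].
  have : h p = 0.
    have [s s0 sP] := Ap; have := fh p (rP p pr).
    rewrite sP; last by rewrite subrr modulus0.
    by move/esym/eqP; rewrite mulf_eq0 expf_eq0 subr_eq0 (negbTE pz) andbF => /eqP.
  move=> hp; have := dP p pd; rewrite hp sub0r modulusN.
  by move: hz0; lra.
by move=> z; rewrite -{1}AO => -[_ [r r0]]; apply; rewrite subrr modulus0.
Qed.

Lemma complex_nth_root n (c : cplx R) : (0 < n)%N -> exists x : cplx R, x ^+ n = c.
Proof. by move=> n0; exists (n.-root (c : R[i])); exact: rootCK. Qed.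

(** If [u] is not locally constant, [u z - u z0] behaves like [c * (z - z0) ^+ n] with [c] nonzero.
    Moving from [z0] in a direction [x] with [x ^+ n = u z0 / c] increases the modulus beyond 1. *)
Lemma maximum_modulus Omega u z0 : open Omega -> holomorphic_on Omega u ->
  (forall z, Omega z -> modulus (u z) <= 1) -> Omega z0 -> modulus (u z0) = 1 ->
  exists2 r : R, 0 < r & forall z, modulus (z - z0) < r -> u z = u z0.
Proof.
move=> oO du uM Oz0 u1.
have dv : holomorphic_on Omega (fun z => u z - u z0).
  by move=> z Oz; apply: derivable_add; [exact: du|exact: derivable_const].
have vM z : Omega z -> modulus (u z - u z0) <= 2.
  by move=> Oz; apply: le_trans (modulusB _ _) _; rewrite u1; have := uM z Oz; lra.
have [[r r0 rP]|[n [h [dh hz fh]]]] := zero_factorization oO dv vM Oz0.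
  by exists r => // z /rP /eqP; rewrite subr_eq0 => /eqP.
exfalso; have n0 : (0 < n)%N.
  case: n fh => // fh; have := fh z0 Oz0; rewrite subrr mul1r => /esym/eqP.
  by rewrite (negbTE hz).
set c := h z0 in hz; have c0 : 0 < modulus c by rewrite modulus_gt0.
have [x xn] := complex_nth_root (u z0 / c) n0.
have c2 : 0 < modulus c / 2 by rewrite divr_gt0.
(* Half of [modulus c] as tolerance keeps the error [B] below [t ^+ n / 2], against a gain of
   [t ^+ n] in the main term [A]. *)
have [d d0 dP] := derivable_continuity (dh z0 Oz0) c2.
have [r r0 rP] := open_modulusP oO Oz0.
pose m := Num.min r d; have m0 : 0 < m by rewrite lt_min r0.
(* The denominator ensures that the step [t * x] is shorter than [m]. *)
pose t := m / (modulus x + 1).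
have x1 : 0 < modulus x + 1 by rewrite ltr_wpDl ?modulus_ge0.
have t0 : 0 < t by rewrite divr_gt0.
pose z := z0 + t%:C%C * x.
have zz0 : z - z0 = t%:C%C * x by rewrite /z addrAC subrr add0r.
have : modulus (z - z0) < m.
  rewrite zz0 modulusM modulus_real gtr0_norm// /t mulrAC ltr_pdivrMr// ltr_pM2l//.
  by rewrite ltrDl.
rewrite lt_min => /andP[zr zd]; have Oz := rP z zr; have hzd := dP z zd.
have := uM z Oz; apply/negP; rewrite -ltNge.
have -> : u z = u z0 * (1 + (t ^+ n)%:C%C) + u z0 * (t ^+ n)%:C%C * ((h z - c) / c).
  rewrite -[u z](subrK (u z0)) fh// zz0 exprMn xn rmorphXn/=.
  by move: (_ ^+ n) => T; field.
set A := u z0 * (1 + _); set B := _ * ((h z - c) / c).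
have T0 : 0 < t ^+ n by rewrite exprn_gt0.
have AE : modulus A = 1 + t ^+ n.
  rewrite /A modulusM u1 mul1r (_ : 1 + _ = (1 + t ^+ n)%:C%C); last by rewrite rmorphD rmorph1.
  by rewrite modulus_real ger0_norm// addr_ge0// ltW.
have BE : modulus B <= t ^+ n / 2.
  rewrite /B modulusM modulusM u1 mul1r modulus_real gtr0_norm// ler_pM2l//.
  by rewrite modulusM modulusV ler_pdivrMr//; lra.
have : modulus A <= modulus (A + B) + modulus B.
  by rewrite -{1}[A](addrK B) modulusB.
by rewrite AE; lra.
Qed.
End LocalTheory.

(** * Bounded holomorphic interpolation *)

Section PickNevanlinna.
Variable R : realType.
Implicit Types (f g h u w : cplx R -> cplx R) (z : cplx R) (Omega : set (cplx R)).

Lemma bounded_modulusP Omega f :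
  [bounded f z | z in Omega] <-> exists M : R, forall z, Omega z -> modulus (f z) <= M.
Proof.
split.
  move=> [m [mr mP]]; have m1 : m < m + 1 by rewrite ltrDl.
  exists (complex.Re (m + 1)) => z Oz; have := mP _ m1 z Oz.
  by rewrite /= normE lecE/= => /andP[].
move=> [M MP]; exists (M%:C%C : cplx R); split; first by rewrite complex_real.
move=> x Mx z Oz; apply: le_trans (ltW Mx).
by rewrite normE lecR MP.
Qed.

Lemma Hinfty_norm_ge Omega f z : Hinfty Omega f -> Omega z ->
  modulus (f z) <= Hinfty_norm Omega f.
Proof.
move=> [_ /bounded_modulusP[M MP]] Oz; apply: ub_le_sup; last by exists z.
by exists M => _ [y Oy <-]; exact: MP.
Qed.

Lemma Hinfty_norm_le Omega f z0 (M : R) : Omega z0 ->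
  (forall z, Omega z -> modulus (f z) <= M) -> Hinfty_norm Omega f <= M.
Proof.
move=> Oz0 MP; apply: ge_sup; first by exists (modulus (f z0)), z0.
by move=> _ [z Oz <-]; exact: MP.
Qed.

Lemma HinftyP Omega f : Hinfty Omega f <-> holomorphic_on Omega f /\
  exists M : R, forall z, Omega z -> modulus (f z) <= M.
Proof. by split=> -[df /bounded_modulusP fM]. Qed.

Lemma Hinfty_cst Omega (c : cplx R) : Hinfty Omega (fun=> c).
Proof.
apply/HinftyP; split; first by move=> z _; exact: derivable_const.
by exists (modulus c).
Qed.

Lemma Hinfty_add Omega f g : Hinfty Omega f -> Hinfty Omega g ->
  Hinfty Omega (fun z => f z + g z).
Proof.
move=> /HinftyP[df [M fM]] /HinftyP[dg [M' gM]]; apply/HinftyP; split.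
  by move=> z Oz; apply: derivable_add; [exact: df|exact: dg].
exists (M + M') => z Oz; rewrite (le_trans (modulusD _ _))// lerD//.
  exact: fM.
exact: gM.
Qed.

Lemma Hinfty_mul Omega f g : Hinfty Omega f -> Hinfty Omega g ->
  Hinfty Omega (fun z => f z * g z).
Proof.
move=> /HinftyP[df [M fM]] /HinftyP[dg [M' gM]]; apply/HinftyP; split.
  by move=> z Oz; apply: derivable_mul; [exact: df|exact: dg].
exists (M * M') => z Oz; rewrite modulusM ler_pM ?modulus_ge0//.
  exact: fM.
exact: gM.
Qed.

Lemma Hinfty_sum Omega (I : eqType) (s : seq I) (F : I -> cplx R -> cplx R) :
  (forall i, Hinfty Omega (F i)) -> Hinfty Omega (fun z => \sum_(i <- s) F i z).
Proof.
move=> HF; elim: s => [|i s IHs].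
  rewrite (_ : (fun _ => _) = fun=> 0); first exact: Hinfty_cst.
  by apply/funext => z; rewrite big_nil.
rewrite (_ : (fun _ => _) = fun z => F i z + \sum_(i <- s) F i z).
  by apply: Hinfty_add; [exact: HF|exact: IHs].
by apply/funext => z; rewrite big_cons.
Qed.

Lemma Hinfty_prod Omega (I : eqType) (s : seq I) (P : pred I) (F : I -> cplx R -> cplx R) :
  (forall i, Hinfty Omega (F i)) -> Hinfty Omega (fun z => \prod_(i <- s | P i) F i z).
Proof.
move=> HF; elim: s => [|i s IHs].
  rewrite (_ : (fun _ => _) = fun=> 1); first exact: Hinfty_cst.
  by apply/funext => z; rewrite big_nil.
have [Pi|nPi] := boolP (P i).
  rewrite (_ : (fun _ => _) = fun z => F i z * \prod_(i <- s | P i) F i z).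
    by apply: Hinfty_mul; [exact: HF|exact: IHs].
  by apply/funext => z; rewrite big_cons Pi.
rewrite (_ : (fun _ => _) = fun z => \prod_(i <- s | P i) F i z); first exact: IHs.
by apply/funext => z; rewrite big_cons (negbTE nPi).
Qed.

(** The Lagrange interpolation polynomial works, as polynomials are bounded on the bounded set
    [Omega]. *)
Lemma Hinfty_interpolation Omega r (zeta c : 'I_r -> cplx R) :
  bounded_set Omega -> injective zeta -> exists2 h, Hinfty Omega h & interpolates zeta c h.
Proof.
move=> bO inj.
have Hid : Hinfty Omega id by split => // z _; exact: derivable_id.
exists (fun z => \sum_(j < r) (c j * \prod_(i < r | i != j) ((z - zeta i) * (zeta j - zeta i)^-1))).
  apply: Hinfty_sum => j; apply: Hinfty_mul; first exact: Hinfty_cst.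
  apply: Hinfty_prod => i; apply: Hinfty_mul; last exact: Hinfty_cst.
  by apply: Hinfty_add; [exact: Hid|exact: Hinfty_cst].
move=> k; rewrite (bigD1 k)//= [X in _ + X]big1 ?addr0 => [|j jk].
  rewrite big1 ?mulr1// => i ik; rewrite divff// subr_eq0.
  by apply: contra ik => /eqP/inj ->.
by rewrite (bigD1 k) ?(eq_sym k)//= subrr mul0r mul0r mulr0.
Qed.

(* Away from p, dividing w by a power of z - p costs only a constant factor; near p, |u| stays
   below 1 by the maximum modulus principle, so a small multiple of the quotient still fits. *)
Lemma remove_zero Omega u w p : open Omega -> connected Omega -> Omega p ->
  holomorphic_on Omega u -> holomorphic_on Omega w ->
  (forall z, Omega z -> modulus (u z) + modulus (w z) <= 1) ->
  (exists2 z, Omega z & w z != 0) ->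
  exists w', [/\ holomorphic_on Omega w',
    forall z, Omega z -> modulus (u z) + modulus (w' z) <= 1, w' p != 0
    & forall z, Omega z -> w z != 0 -> w' z != 0].
Proof.
move=> oO cO Op du dw uw [q Oq wq].
have wM z : Omega z -> modulus (w z) <= 1.
  by move=> /uw; have := modulus_ge0 (u z); lra.
have uM z : Omega z -> modulus (u z) <= 1.
  by move=> /uw; have := modulus_ge0 (w z); lra.
have nloc : ~ exists2 r : R, 0 < r & forall z, modulus (z - p) < r -> w z = 0.
  move=> /(identity_theorem oO cO dw wM Op)/(_ q Oq)/eqP; exact/negP.
(* If the modulus were 1 at [p], then [u] would be constant near [p], which leaves no room for [w]:
   it would vanish near [p], against [nloc]. *)
have up : modulus (u p) < 1.
  rewrite lt_neqAle uM// andbT; apply/negP => /eqP up1; apply: nloc.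
  have [r r0 rP] := maximum_modulus oO du uM Op up1.
  have [r' r'0 r'P] := open_modulusP oO Op.
  exists (Num.min r r'); first by rewrite lt_min r0.
  move=> z; rewrite lt_min => /andP[/rP uz /r'P/uw]; rewrite uz up1 => wz.
  apply/eqP; rewrite -modulus_eq0; have := modulus_ge0 (w z) => wz0.
  by rewrite eq_le wz0 andbT; lra.
have [//|[n [h [dh hp wh]]]] := zero_factorization oO dw wM Op.
pose de := (1 - modulus (u p)) / 2; have de0 : 0 < de by rewrite divr_gt0// subr_gt0.
have [d1 d10 d1P] := derivable_continuity (du p Op) de0.
have [d2 d20 d2P] := derivable_continuity (dh p Op) ltr01.
pose d := Num.min d1 d2; have d0 : 0 < d by rewrite lt_min d10.
have hp1 : 0 < modulus (h p) + 1 by rewrite ltr_wpDl ?modulus_ge0.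
(* The first bound gives [e * modulus (h z) <= modulus (w z)] at distance at least [d] from [p]; the
   second makes [e * modulus (h z)] at most [de] closer to [p], where [modulus (u z)] is at most
   [1 - de]. *)
pose e := Num.min (d ^+ n) (de / (modulus (h p) + 1)).
have e0 : 0 < e by rewrite lt_min exprn_gt0// divr_gt0.
have ne : (e%:C%C : cplx R) != 0 by rewrite -modulus_eq0 modulus_real normr_eq0 lt0r_neq0.
exists (fun z => e%:C%C * h z); split.
- by move=> z Oz; apply: derivable_mul; [exact: derivable_const|exact: dh].
- move=> z Oz; rewrite modulusM modulus_real gtr0_norm//.
  have [zd|dz] := ltrP (modulus (z - p)) d.
    move: zd; rewrite lt_min => /andP[/d1P h1 /d2P h2].
    have H1 : modulus (u z) <= modulus (u p) + de.
      by rewrite -lerBlDl (le_trans (modulus_triangle _ _)).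
    have H2 : modulus (h z) <= modulus (h p) + 1.
      by rewrite -lerBlDl (le_trans (modulus_triangle _ _)).
    have H3 : e * modulus (h z) <= de.
      apply: (@le_trans _ _ (de / (modulus (h p) + 1) * (modulus (h p) + 1))).
        by rewrite ler_pM ?modulus_ge0 ?(ltW e0)// ge_min lexx orbT.
      by rewrite divfK// lt0r_neq0.
    by move: H1 H3; rewrite /de; lra.
  apply: le_trans (uw z Oz); rewrite lerD2l (wh z Oz) modulusM modulusX.
  rewrite ler_wpM2r ?modulus_ge0//; apply: (@le_trans _ _ (d ^+ n)).
    by rewrite ge_min lexx.
  by rewrite lerXn2r ?nnegrE ?modulus_ge0// ltW.
- by rewrite mulf_neq0.
- move=> z Oz; rewrite (wh z Oz) mulf_eq0 negb_or => /andP[_ hz].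
  by rewrite mulf_neq0.
Qed.

(** The points are treated one at a time; [remove_zero] creates no new zeros, so earlier progress is
    kept. *)
Lemma remove_zeros Omega u w (s : seq (cplx R)) : open Omega -> connected Omega ->
  (forall p, p \in s -> Omega p) -> holomorphic_on Omega u -> holomorphic_on Omega w ->
  (forall z, Omega z -> modulus (u z) + modulus (w z) <= 1) ->
  (exists2 z, Omega z & w z != 0) ->
  exists w', [/\ holomorphic_on Omega w',
    forall z, Omega z -> modulus (u z) + modulus (w' z) <= 1
    & forall z, Omega z -> (z \in s) || (w z != 0) -> w' z != 0].
Proof.
move=> oO cO + du dw uw [q Oq wq]; elim: s => [|p s IHs] sO; first by exists w.
have [|w1 [dw1 uw1 w1s]] := IHs.
  by move=> x xs; apply: sO; rewrite inE xs orbT.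
have [||w2 [dw2 uw2 w2p w2s]] := remove_zero oO cO (sO p _) du dw1 uw1.
- by rewrite inE eqxx.
- by exists q => //; apply: w1s => //; rewrite wq orbT.
exists w2; split => // z Oz; rewrite inE -orbA => /orP[/eqP->//|zs].
by apply: w2s => //; exact: w1s.
Qed.

Lemma distinct_solutions_improve Omega r (zeta tau : 'I_r -> cplx R) f g q :
  open Omega -> connected Omega -> bounded_set Omega ->
  (forall j, Omega (zeta j)) -> injective zeta ->
  pick_nevanlinna_solution Omega zeta tau f -> pick_nevanlinna_solution Omega zeta tau g ->
  Omega q -> f q != g q ->
  exists F (c : R), [/\ c < 1, holomorphic_on Omega F,
    forall z, Omega z -> modulus (F z) <= c & interpolates zeta tau F].
Proof.
move=> oO cO bO Oz inj [df fM ft] [dg gM gt] Oq fgq.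
pose u z := 2^-1 * (f z + g z); pose v z := 2^-1 * (f z - g z).
pose w z := 2^-1 * (v z * v z).
have m2 : modulus (2^-1 : cplx R) = 2^-1 by rewrite modulusV (modulus_nat R 2).
have du : holomorphic_on Omega u.
  move=> z Zz; apply: derivable_mul; first exact: derivable_const.
  by apply: derivable_add; [exact: df|exact: dg].
have dv : holomorphic_on Omega v.
  move=> z Zz; have -> : v = fun z => 2^-1 * (f z + (-1) * g z).
    by apply/funext => x; rewrite mulN1r.
  apply: derivable_mul; first exact: derivable_const.
  apply: derivable_add; first exact: df.
  by apply: derivable_mul; [exact: derivable_const|exact: dg].
have dw : holomorphic_on Omega w.
  move=> z Zz; apply: derivable_mul; first exact: derivable_const.
  by apply: derivable_mul; exact: dv.
(* [|u|^2 + |v|^2 <= 1] by the parallelogram law, hence [|u| <= 1 - |v|^2 / 2] *)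
have uw z : Omega z -> modulus (u z) + modulus (w z) <= 1.
  move=> Zz; have := modulus_parallelogram (f z) (g z).
  have := fM z Zz; have := gM z Zz; rewrite /u /w /v !modulusM !m2.
  have := modulus_ge0 (f z); have := modulus_ge0 (g z).
  have := modulus_ge0 (f z + g z); have := modulus_ge0 (f z - g z).
  move: (modulus (f z + g z)) (modulus (f z - g z)) (modulus (f z)) (modulus (g z)).
  move=> A B x y B0 A0 y0 x0 y1 x1 P.
  have P4 : (2^-1 * A) ^+ 2 <= 1 - (2^-1 * B) ^+ 2 by nra.
  move: P4; set a := 2^-1 * A; set b := 2^-1 * B => P4.
  have b1 : b ^+ 2 <= 1 by have := sqr_ge0 a; lra.
  rewrite -lerBrDr -ler_sqr ?nnegrE.
  - apply: le_trans P4 _; nra.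
  - by rewrite /a mulr_ge0// invr_ge0.
  - by rewrite subr_ge0; nra.
have [||w' [dw' uw' w's]] := @remove_zeros Omega u w (codom zeta) oO cO _ du dw uw.
- by move=> p /codomP[j ->].
- exists q => //; rewrite /w /v !mulf_neq0 ?invr_eq0 ?subr_eq0//.
(* The data are chosen so that [w' * h] takes the value [tau j] at [zeta j]; then [u + e * w' * h]
   takes the value [(1 + e) * tau j]. *)
have [h /HinftyP[dh [M hM]] hint] :=
  @Hinfty_interpolation Omega r zeta (fun j => tau j / w' (zeta j)) bO inj.
(* With this [e], the modulus of [e * h] is at most 1, so [u + e * w' * h] is bounded by
   [modulus (u z) + modulus (w' z)], hence by 1. *)
pose e := (`|M| + 1)^-1.
have M1 : 0 < `|M| + 1 by rewrite ltr_wpDl.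
have e0 : 0 < e by rewrite invr_gt0.
have c1 : (1 + e)%:C%C != 0 :> cplx R.
  by rewrite -modulus_eq0 modulus_real normr_eq0 lt0r_neq0// addr_gt0.
exists (fun z => ((1 + e)%:C%C)^-1 * (u z + e%:C%C * (w' z * h z))), (1 + e)^-1; split.
- by rewrite invf_lt1 ?ltrDl// addr_gt0.
- move=> z Zz; apply: derivable_mul; first exact: derivable_const.
  apply: derivable_add; first exact: du.
  apply: derivable_mul; first exact: derivable_const.
  by apply: derivable_mul; [exact: dw'|exact: dh].
- move=> z Zz; rewrite modulusM modulusV modulus_real gtr0_norm ?addr_gt0//.
  rewrite ler_piMr ?invr_ge0 ?addr_ge0 ?(ltW e0)//.
  apply: le_trans (modulusD _ _) _; apply: le_trans (uw' z Zz); rewrite lerD2l.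
  rewrite !modulusM modulus_real gtr0_norm// mulrCA ler_piMr ?modulus_ge0//.
  rewrite mulrC ler_pdivrMr// mul1r (le_trans (hM z Zz))// (le_trans (ler_norm _))// lerDl//.
- move=> j /=; rewrite hint [w' _ * _]mulrC divfK; last by rewrite w's ?codom_f.
  rewrite /u ft gt (_ : 2^-1 * (tau j + tau j) = tau j); last by field.
  apply: (mulfI c1); rewrite mulrA divff// mul1r rmorphD rmorph1; ring.
Qed.

(** Interpolants with norm at most [m + n.+1%:R^-1], where [m] is the infimum, have a pointwise
    generalized limit; it is holomorphic, keeps the interpolation values and is bounded by [m]. *)
Lemma minimal_interpolant Omega r (zeta tau : 'I_r -> cplx R) :
  open Omega -> bounded_set Omega -> Omega !=set0 ->
  (forall j, Omega (zeta j)) -> injective zeta ->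
  exists m : R, is_min (interpolant_norms Omega zeta tau) m.
Proof.
move=> oO bO [z0 Oz0] Oz inj.
set S := interpolant_norms Omega zeta tau.
have S0 : S !=set0.
  have [h Hh hint] := Hinfty_interpolation tau bO inj.
  by exists (Hinfty_norm Omega h), h.
have Slb : lbound S 0.
  move=> _ [f [Hf _] <-]; exact: le_trans (modulus_ge0 _) (Hinfty_norm_ge Hf Oz0).
have hiS : has_inf S by split => //; exists 0.
pose m := inf S.
have lbm : lbound S m by move=> x Sx; apply: ge_inf => //; exists 0.
have /choice[fs fsP] : forall n : nat, exists f, [/\ Hinfty Omega f, interpolates zeta tau f
    & forall z, Omega z -> modulus (f z) <= m + n.+1%:R^-1].
  move=> n; have n0 : 0 < n.+1%:R^-1 :> R by rewrite invr_gt0.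
  have [_ [f [Hf fint] <-] fm] := inf_adherent n0 hiS.
  by exists f; split => // z Zz; exact: le_trans (Hinfty_norm_ge Hf Zz) (ltW fm).
have [L GL] := generalized_limit_exists R; have [_ _ Lc Lb] := GL.
have fs1 n z : Omega z -> modulus (fs n z) <= m + 1.
  move=> Zz; have [_ _ /(_ z Zz)] := fsP n; move=> /le_trans; apply.
  by rewrite lerD2l invf_le1 ?ler1n.
pose f z := L (fun n => fs n z).
have df : holomorphic_on Omega f.
  apply: (generalized_limit_holomorphic GL oO _ fs1) => n.
  by have [[]] := fsP n.
have fm z : Omega z -> modulus (f z) <= m.
  move=> Zz; apply/ler_addgt0Pr => e e0.
  (* From this index on, [n.+1] exceeds [e^-1], so the excess over [m] is below [e]. *)
  apply: (Lb _ _ (Num.trunc e^-1)).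
    by exists (m + 1) => n; exact: fs1.
  move=> n en; have [_ _ /(_ z Zz)] := fsP n; move=> /le_trans; apply.
  rewrite lerD2l -[e]invrK lef_pV2 ?posrE ?invr_gt0//.
  by rewrite ltW// (lt_le_trans (truncnS_gt _))// ler_nat.
have fint : interpolates zeta tau f.
  move=> j; rewrite /f (_ : (fun n => _) = fun=> tau j) ?Lc//.
  by apply/funext => n; have [_ -> _] := fsP n.
have Hf : Hinfty Omega f by apply/HinftyP; split => //; exists m.
have Sf : S (Hinfty_norm Omega f) by exists f.
exists m; split => //; suff <- : Hinfty_norm Omega f = m by [].
by apply/le_anti; rewrite lbm// andbT; exact: Hinfty_norm_le Oz0 fm.
Qed.
End PickNevanlinna.

(** * Solvability and extremal uniqueness in terms of the minimal norm *)

Unset Implicit Arguments.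

Theorem mainTheorem5 (R : realType) (k : nat) (Omega : set (cplx R))
    (Gamma : 'I_k.+1 -> set (cplx R)) (r : nat) (zeta tau : 'I_r -> cplx R)
    (hOmega : analytic_domain Omega Gamma)
    (hzeta : forall j, Omega (zeta j)) (hdistinct : injective zeta)
    (htau : exists j, tau j <> 0) :
  exists mstar : R,
    [/\ is_min (interpolant_norms Omega zeta tau) mstar,
        (exists f, pick_nevanlinna_solution Omega zeta tau f) <-> mstar <= 1
      & mstar = 1 ->
        exists2 f, pick_nevanlinna_solution Omega zeta tau f
          & forall g, pick_nevanlinna_solution Omega zeta tau g ->
            forall z, Omega z -> g z = f z].
Proof.
have [[oO cO bO] _ _ _ _] := hOmega.
(* A node provides a point of [Omega], so that suprema over [Omega] are taken over nonempty sets. *)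
have [j0 _] := htau; have Oz0 := hzeta j0.
have O0 : Omega !=set0 by exists (zeta j0).
have [m [[f [Hf fint] fm] lbm]] := minimal_interpolant tau oO bO O0 hzeta hdistinct.
have fsol : m <= 1 -> pick_nevanlinna_solution Omega zeta tau f.
  move=> m1; split => //; first by case: Hf.
  by move=> z Zz; rewrite (le_trans (Hinfty_norm_ge Hf Zz))// fm.
have mle F (c : R) : holomorphic_on Omega F -> (forall z, Omega z -> modulus (F z) <= c) ->
    interpolates zeta tau F -> m <= c.
  move=> dF Fc Fint; apply: le_trans (Hinfty_norm_le Oz0 Fc); apply: lbm.
  by exists F => //; split => //; apply/HinftyP; split => //; exists c.
exists m; split.
- by split => //; exists f.
- by split => [[F [dF F1 Fint]]|m1]; [exact: mle Fint|exists f; exact: fsol].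
- move=> m1; exists f; first by apply: fsol; rewrite m1.
  (* A solution that differs from [f] at [z] would yield an interpolant bounded by some [c < 1],
     against the minimality of [m = 1]. *)
  move=> g gsol z Zz; apply/eqP; apply: contraT => gf.
  have fs : pick_nevanlinna_solution Omega zeta tau f by apply: fsol; rewrite m1.
  have [F [c [c1 dF Fc Fint]]] :=
    distinct_solutions_improve oO cO bO hzeta hdistinct gsol fs Zz gf.
  by have := mle F c dF Fc Fint; rewrite m1 leNgt c1.
Qed.
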